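(* Let $f\in\mathbb{R}^N$, $k\in\mathbb{N}$, and $\beta,\gamma>0$. The proposed algorithm (the dynamic program with Givens-rotation error updates and pruning described in the context) computes a global minimizer of the higher order Mumford-Shah problem $(P_{k,\beta,\gamma})$ with data $f$. Its worst case time complexity is $O(N^2)$.
   Context: **Problem.** Let $\Omega=\{1,\dots,N\}$ and write $l{:}r=\{l,\dots,r\}$. A partition $\mathcal{I}$ of $\Omega$ means a partition into discrete intervals $l{:}r$, $1\le l\le r\le N$; $|\mathcal{I}|$ is its number of intervals. For an interval $I=l{:}r$, $u_I=(u_l,\dots,u_r)$. For $v\in\mathbb{R}^q$ with $q>k$, $\nabla^k v\in\mathbb{R}^{q-k}$ is the $k$-th order finite difference $(\nabla^k v)_i=\sum_{j=0}^k(-1)^{k-j}\binom{k}{j}v_{i+j}$; for $q\le k$ it is the empty vector (norm zero). The problem $(P_{k,\beta,\gamma})$ is to minimize $$\|u-f\|_2^2+\sum_{I\in\mathcal{I}}\beta^{2k}\|\nabla^k u_I\|_2^2+\gamma|\mathcal{I}|$$ over all pairs $(u,\mathcal{I})$ with $u\in\mathbb{R}^N$ and $\mathcal{I}$ a partition of $\Omega$. The complexity $O(N^2)$ refers to the signal length $N$. **Approximation errors.** For an interval $I$ let $\mathcal{E}^I=\min_{v\in\mathbb{R}^{|I|}}\|v-f_I\|_2^2+\beta^{2k}\|\nabla^k v\|_2^2$; so $\mathcal{E}^I=0$ if $|I|\le k$. **The proposed algorithm.** (1) *Precomputation of the recurrence coefficients.* Let $A\in\mathbb{R}^{(2N-k)\times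 N}$ be the $N\times N$ identity matrix stacked on top of $\beta^k\nabla^k\in\mathbb{R}^{(N-k)\times N}$. A Givens rotation $G(j,m,\theta)$ is the identity matrix except for the entries $G_{jj}=G_{mm}=\cos\theta$, $G_{jm}=\sin\theta$, $G_{mj}=-\sin\theta$. Start with $R^{(k)}$ the $k\times k$ identity. For $r=k,\dots,N-1$, extend the upper triangular matrix $R^{(r)}$ by a row and column to $\begin{pmatrix}R^{(r)}&0\\0&1\end{pmatrix}$, append the first $r+1$ entries of row $N+r-k+1$ of $A$ as a last row (only its last $k+1$ entries are nonzero), and eliminate this row by $k+1$ successive Givens rotations, which gives $R^{(r+1)}$. The rotation eliminating an entry $a$ in column $j$ by the diagonal pivot $b$ has angle $\theta$ with $\cos\theta=b/\rho$, $\sin\theta=a/\rho$, $\rho=\mathrm{sign}(b)\sqrt{a^2+b^2}$. The angles $\Theta_{N+r+1-k,\,r-k+j}$, $j=1,\dots,k+1$, are stored; they do not depend on the data and are reused for all intervals. (2) *Error update.* For a left bound $l$ and interval length $r\ge k$ (i.e. the interval $l{:}(l+r-1)$), a vector $q^{(r)}\in\mathbb{R}^{2r-k}$ is maintained, starting with $q^{(k)}=(f_l,\dots,f_{l+k-1})^T$. The update is $$q^{(r+1)}=G^{(r+1)}\begin{pmatrix}q^{(r)}_{1:r}\\ f_{l+r}\\ q^{(r)}_{r+1:2r-k}\\ 0\end{pmatrix},\qquad \mathcal{E}^{l:(l+r)}=\mathcal{E}^{l:(l+r-1)}+\big(q^{(r+1)}_{2(r+1)-k}\big)^2,$$ where $G^{(r+1)}=Z_{k+1}\cdots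 Z_1$ with $Z_j=G\big(r-k+j,\,2(r+1)-k,\,\Theta_{N+r+1-k,\,r-k+j}\big)$. The matrix $G^{(r+1)}$ is not formed explicitly; the rotations are applied one by one. For lengths at most $k$ the error is $0$. (3) *Dynamic program with pruning.* First compute $\mathcal{E}^{1:r}$ for $r=1,\dots,N$. Set $P^*_1=0$, $J_1=0$, and initialize a list of candidate left bounds $L=[2]$, where each candidate $l$ carries its current right bound $s$ and current error $\mathcal{E}^{l:s}$ (initially $s=l$, error $0$). For $r=2,\dots,N$: set $P^*_r=\mathcal{E}^{1:r}$, $J_r=0$; then run through the candidates $l$ in $L$ in descending order. For each $l$, as long as its current right bound $s$ is less than $r$, increase $s$ by one by the error update (2) and, after each update, check whether $P^*_{l-1}+\mathcal{E}^{l:s}\ge P^*_s$; if so, delete $l$ from $L$ for good and pass to the next candidate. If $l$ is not deleted, set $b=P^*_{l-1}+\gamma+\mathcal{E}^{l:r}$, and if $b\le P^*_r$ put $P^*_r=b$, $J_r=l-1$. Then, if $\mathcal{E}^{l:r}+\gamma>P^*_r$, stop running through the candidates for this $r$. After the run, prepend the candidate $r+1$ (right bound $r+1$, error $0$) to $L$. (In this normalization $P^*_r$ is the minimal functional value for the data $f_{1:r}$ minus the constant $\gamma$.) (4) *Reconstruction.* Recover $\mathcal{I}^*$ from $J$: start with $r=N$, and while $r>0$ let $l=J_r+1$, add the interval $l{:}r$ to $\mathcal{I}^*$, and put $r=l-1$. For each $I\in\mathcal{I}^*$ compute $u^*_I=\mathrm{argmin}_{v\in\mathbb{R}^{|I|}}\|v-f_I\|_2^2+\beta^{2k}\|\nabla^k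 v\|_2^2$ by solving the banded least squares problem (by QR decomposition, reusing the stored angles). The output is $(u^*,\mathcal{I}^* )$. *)

(* Defs.v *)
(* Mathematical Components, with MathComp-Analysis for the reals and sin, cos, asin. *)
From HB Require Import structures.
From mathcomp Require Import all_boot all_order all_algebra.
From mathcomp Require Import reals trigo.

Set Implicit Arguments.
Unset Strict Implicit.
Unset Printing Implicit Defensive.

Import Order.TTheory GRing.Theory Num.Theory.
Local Open Scope ring_scope.

Section Problem.
Variable R : realType.

Definition sqnorm (q : nat) (v : 'rV[R]_q) : R := \sum_(i < q) v 0 i ^+ 2.

Fact nabla_index (k q : nat) (i : 'I_(q - k)) (j : 'I_k.+1) : (i + j < q)%N.
Proof.
case: i j => i /= hi [j /= hj]; rewrite ltnS in hj.
by apply: leq_ltn_trans (leq_add (leqnn i) hj) _; rewrite addnC -ltn_subRL.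
Qed.

(* For q <= k the truncated subtraction makes this the empty vector. *)
Definition nabla (k q : nat) (v : 'rV[R]_q) : 'rV[R]_(q - k) :=
  \row_(i < q - k)
    \sum_(j < k.+1) (-1) ^+ (k - j) * 'C(k, j)%:R * v 0 (Ordinal (nabla_index i j)).

(* The discrete interval l:r is represented by the pair of its bounds, which are
   0-based as elements of 'I_N: (l, r) stands for l.+1:r.+1. *)
Definition block (N : nat) (I : 'I_N * 'I_N) : {set 'I_N} :=
  [set i : 'I_N | I.1 <= i <= I.2]%N.

Fact subvector_index (N : nat) (I : 'I_N * 'I_N) (i : 'I_(I.2 - I.1).+1) :
  (I.1 + i < N)%N.
Proof.
case: I i => l r [i /=]; rewrite ltnS => hi.
apply: leq_ltn_trans (leq_add (leqnn l) hi) _.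
by rewrite -maxnE gtn_max !ltn_ord.
Qed.

Definition subvector (N : nat) (u : 'rV[R]_N) (I : 'I_N * 'I_N) :
    'rV[R]_(I.2 - I.1).+1 :=
  \row_(i < (I.2 - I.1).+1) u 0 (Ordinal (subvector_index i)).

(* [partition] excludes the empty block, hence forces l <= r for all (l, r) in P;
   distinct pairs in P are then distinct blocks and #|P| is the number of intervals. *)
Definition itv_partition (N : nat) (P : {set 'I_N * 'I_N}) : bool :=
  partition [set block I | I in P] [set: 'I_N].

Definition functional (k N : nat) (beta gamma : R) (f u : 'rV[R]_N)
    (P : {set 'I_N * 'I_N}) : R :=
  sqnorm (u - f)
  + \sum_(I in P) beta ^+ (2 * k) * sqnorm (nabla k (subvector u I))
  + gamma * #|P|%:R.

Definition global_minimizer (k N : nat) (beta gamma : R) (f u : 'rV[R]_N)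
    (P : {set 'I_N * 'I_N}) : Prop :=
  itv_partition P /\
  forall (v : 'rV[R]_N) (Q : {set 'I_N * 'I_N}), itv_partition Q ->
    functional k beta gamma f u P <= functional k beta gamma f v Q.

End Problem.

(* Cost model: a real RAM, i.e. a machine with unit cost real arithmetic and unit cost
   random access memory. Programs are polymorphic in the type V of reals, so that the
   only way for them to compute with, compare, read or write reals is through the
   instructions below, each of which costs one unit of time. Control flow is written in
   the host language; index arithmetic, branching and the handling of a list cell take
   constant time per instruction, and [Tick] charges each round of a loop and each visit
   of a list cell. *)

(* Each array is indexed by two naturals; one-dimensional arrays have first index 0,
   and all indices start at 1 as in the mathematical description. *)
Inductive array :=
  | Data | Theta | Rmx | Row | Qtop | Qbot | Err1 | Pstar | Sol.

Definition array_eq_dec (x y : array) : {x = y} + {x <> y}.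
Proof. by decide equality. Defined.

HB.instance Definition _ := hasDecEq.Build array (compareP array_eq_dec).

Definition addr : Type := (array * nat * nat)%type.

Inductive operation (V : Type) :=
  | Lit of int
  | Plus of V & V
  | Minus of V & V
  | Times of V & V
  | Over of V & V
  | Sqrt of V
  | Sign of V
  | Sin of V
  | Cos of V
  | Asin of V.

(* [ReadN] and [WriteN] access the one array of naturals, J. *)
Inductive prog (V A : Type) :=
  | Ret of A
  | Tick of prog V A
  | Op of operation V & (V -> prog V A)
  | Leq of V & V & (bool -> prog V A)
  | Read of addr & (V -> prog V A)
  | Write of addr & V & prog V A
  | ReadN of nat & (nat -> prog V A)
  | WriteN of nat & nat & prog V A.

Arguments Lit {V} _.
Arguments Ret {V A} _.

Fixpoint bind (V A B : Type) (p : prog V A) (g : A -> prog V B) : prog V B :=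
  match p with
  | Ret a => g a
  | Tick p' => Tick (bind p' g)
  | Op o h => Op o (fun x => bind (h x) g)
  | Leq x y h => Leq x y (fun b => bind (h b) g)
  | Read a h => Read a (fun x => bind (h x) g)
  | Write a x p' => Write a x (bind p' g)
  | ReadN i h => ReadN i (fun n => bind (h n) g)
  | WriteN i n p' => WriteN i n (bind p' g)
  end.

Record state (V : Type) := State {
  rmem : addr -> V;
  nmem : nat -> nat;
  clock : nat }.

Section Machine.
Variable R : realType.

Definition eval (o : operation R) : R :=
  match o with
  | Lit z => z%:~R
  | Plus x y => x + y
  | Minus x y => x - y
  | Times x y => x * y
  | Over x y => x / y
  | Sqrt x => Num.sqrt x
  | Sign x => Num.sg x
  | Sin x => sin x
  | Cos x => cos x
  | Asin x => asin x
  end.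

Definition step (s : state R) : state R := State (rmem s) (nmem s) (clock s).+1.

Definition store (a : addr) (x : R) (s : state R) : state R :=
  State (fun b => if b == a then x else rmem s b) (nmem s) (clock s).

Definition storeN (i n : nat) (s : state R) : state R :=
  State (rmem s) (fun j => if j == i then n else nmem s j) (clock s).

Fixpoint run (A : Type) (p : prog R A) (s : state R) : A * state R :=
  match p with
  | Ret a => (a, s)
  | Tick p' => run p' (step s)
  | Op o h => run (h (eval o)) (step s)
  | Leq x y h => run (h (x <= y)) (step s)
  | Read a h => run (h (rmem s a)) (step s)
  | Write a x p' => run p' (step (store a x s))
  | ReadN i h => run (h (nmem s i)) (step s)
  | WriteN i n p' => run p' (step (storeN i n s))
  end.

Definition initial_state (N : nat) (f : 'rV[R]_N) : state R :=
  State
    (fun a => if a is (Data, 0, i.+1)%N then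
                if insub i is Some j then f 0 j else 0
              else 0)
    (fun _ => 0%N) 0%N.

End Machine.

Notation "'let!' x := p 'in' q" := (bind p (fun x => q))
  (at level 200, x name, q at level 200).
Notation "p ;; q" := (bind p (fun _ : unit => q))
  (at level 199, right associativity).

Section Algorithm.
Local Open Scope nat_scope.

Variables (V : Type) (beta gamma : V) (k N : nat).

Local Notation P := (prog V).

Definition tick : P unit := Tick (Ret tt).
Definition op (o : operation V) : P V := Op o Ret.
Definition leq_real (x y : V) : P bool := Leq x y Ret.
Definition read (a : addr) : P V := Read a Ret.
Definition write (a : addr) (x : V) : P unit := Write a x (Ret tt).
Definition readN (i : nat) : P nat := ReadN i Ret.
Definition writeN (i n : nat) : P unit := WriteN i n (Ret tt).

Definition from_to (a b : nat) : seq nat := index_iota a b.+1.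

Fixpoint fold (T A : Type) (s : seq T) (body : A -> T -> P A) (acc : A) : P A :=
  if s is i :: s' then
    tick;; let! acc' := body acc i in fold s' body acc'
  else Ret acc.

Definition for_each (T : Type) (s : seq T) (body : T -> P unit) : P unit :=
  fold s (fun _ i => body i) tt.

Definition power (x : V) (n : nat) : P V :=
  let! one := op (Lit 1) in
  fold (from_to 1 n) (fun y _ => op (Times y x)) one.

(* Multiplication of a vector by G(j, m, theta), where x and y are the addresses of its
   entries j and m. *)
Definition rotate (theta : V) (x y : addr) : P unit :=
  let! c := op (Cos theta) in
  let! s := op (Sin theta) in
  let! vx := read x in
  let! vy := read y in
  let! cx := op (Times c vx) in
  let! sy := op (Times s vy) in
  let! x' := op (Plus cx sy) in
  let! sx := op (Times s vx) in
  let! cy := op (Times c vy) in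
  let! y' := op (Minus cy sx) in
  write x x';; write y y'.

(* Since cos theta = b / rho = `|b| / sqrt (a ^ 2 + b ^ 2) is nonnegative, the angle
   with cos theta = b / rho and sin theta = a / rho is asin (a / rho). *)
Definition angle (a b : V) : P V :=
  let! a2 := op (Times a a) in
  let! b2 := op (Times b b) in
  let! d := op (Plus a2 b2) in
  let! n := op (Sqrt d) in
  let! sb := op (Sign b) in
  let! rho := op (Times sb n) in
  let! x := op (Over a rho) in
  op (Asin x).

(* R^(k) is the identity. Only the entries i <= j <= i + k of R^(r) are ever nonzero;
   the other ones are never read and are left out when R^(r) is extended. *)
Definition init_R : P unit :=
  for_each (from_to 1 k) (fun i => for_each (from_to 1 k) (fun j =>
    let! x := op (Lit (i == j)%:Z) in write (Rmx, i, j) x)).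

(* The array Row, indexed by columns, holds the row appended to R^(r) (+) 1, that is
   row N + r - k + 1 of A; bk is beta ^ k. *)
Definition extend_R (bk : V) (r : nat) : P unit :=
  let! zero := op (Lit 0) in
  let! one := op (Lit 1) in
  for_each (from_to (r - k + 1) r) (fun i => write (Rmx, i, r + 1) zero);;
  write (Rmx, r + 1, r + 1) one;;
  for_each (from_to 0 k) (fun j =>
    let! c := op (Lit ((-1) ^+ (k - j) * 'C(k, j)%:Z)%R) in
    let! x := op (Times bk c) in
    write (Row, 0, r - k + 1 + j) x).

Definition eliminate (theta : V) (r j : nat) : P unit :=
  for_each (from_to j (r + 1)) (fun c => rotate theta (Rmx, j, c) (Row, 0, c)).

Definition theta_addr (r j : nat) : addr := (Theta, N + r + 1 - k, r - k + j).

Definition precompute (bk : V) : P unit :=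
  init_R;;
  for_each (index_iota k N) (fun r =>
    extend_R bk r;;
    for_each (from_to 1 (k + 1)) (fun j =>
      let! a := read (Row, 0, r - k + j) in
      let! b := read (Rmx, r - k + j, r - k + j) in
      let! theta := angle a b in
      write (theta_addr r j) theta;;
      eliminate theta r (r - k + j))).

(* Address of entry i of the vector q^(r) of left bound l. The first r entries and the
   last r - k ones are stored in two arrays, so that inserting an entry at position
   r + 1 and appending an entry at the end does not move the other ones. *)
Definition q_addr (l r i : nat) : addr :=
  if i <= r then (Qtop, l, i) else (Qbot, l, i - r).

Definition init_q (l : nat) : P unit :=
  for_each (from_to 1 k) (fun i =>
    let! x := read (Data, 0, l + i - 1) in write (q_addr l k i) x).

Definition update_q (l r : nat) : P unit :=
  let! x := read (Data, 0, l + r) in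
  write (q_addr l (r + 1) (r + 1)) x;;
  let! zero := op (Lit 0) in
  write (q_addr l (r + 1) (2 * (r + 1) - k)) zero;;
  for_each (from_to 1 (k + 1)) (fun j =>
    let! theta := read (theta_addr r j) in
    rotate theta (q_addr l (r + 1) (r - k + j)) (q_addr l (r + 1) (2 * (r + 1) - k))).

(* From the error e of l:s to the error of l:(s + 1). *)
Definition update_error (l s : nat) (e : V) : P V :=
  let r := s + 1 - l in
  if r < k then op (Lit 0)
  else
    (if r == k then init_q l else Ret tt);;
    update_q l r;;
    let! x := read (q_addr l (r + 1) (2 * (r + 1) - k)) in
    let! x2 := op (Times x x) in
    op (Plus e x2).

Definition first_errors : P unit :=
  let! zero := op (Lit 0) in
  write (Err1, 0, 1) zero;;
  for_each (from_to 2 N) (fun r =>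
    let! e := read (Err1, 0, r - 1) in
    let! e' := update_error 1 (r - 1) e in
    write (Err1, 0, r) e').

(* A candidate left bound l, with its current right bound s and error of l:s. *)
Record candidate := Candidate { lb : nat; rb : nat; err : V }.

(* The answer None means that the candidate is deleted; n is the number of updates that
   the right bound lags behind. *)
Fixpoint advance (n : nat) (c : candidate) : P (option candidate) :=
  if n is n'.+1 then
    tick;;
    let s := rb c + 1 in
    let! e := update_error (lb c) (rb c) (err c) in
    let! p := read (Pstar, 0, lb c - 1) in
    let! x := op (Plus p e) in
    let! ps := read (Pstar, 0, s) in
    let! prune := leq_real ps x in
    if prune then Ret None else advance n' (Candidate (lb c) s e)
  else Ret (Some c).

Fixpoint scan (r : nat) (L : seq candidate) : P (seq candidate) :=
  tick;;
  if L is c :: L' then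
    let! oc := advance (r - rb c) c in
    if oc is Some c' then
      let! p := read (Pstar, 0, lb c' - 1) in
      let! x := op (Plus p gamma) in
      let! b := op (Plus x (err c')) in
      let! pr := read (Pstar, 0, r) in
      let! better := leq_real b pr in
      (if better then write (Pstar, 0, r) b;; writeN r (lb c' - 1) else Ret tt);;
      let! y := op (Plus (err c') gamma) in
      let! pr' := read (Pstar, 0, r) in
      let! continue := leq_real y pr' in
      if continue then let! L'' := scan r L' in Ret (c' :: L'') else Ret (c' :: L')
    else scan r L'
  else Ret [::].

Definition dynamic_program : P unit :=
  first_errors;;
  let! zero := op (Lit 0) in
  write (Pstar, 0, 1) zero;;
  writeN 1 0;;
  let! L := fold (from_to 2 N) (fun L r =>
    let! e := read (Err1, 0, r) in
    write (Pstar, 0, r) e;;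
    writeN r 0;;
    let! L' := scan r L in
    Ret (Candidate (r + 1) (r + 1) zero :: L')) [:: Candidate 2 2 zero] in
  Ret tt.

(* The loop runs while r > 0; n bounds the number of its rounds. *)
Fixpoint segments (n r : nat) : P (seq (nat * nat)) :=
  if n is n'.+1 then
    if r == 0 then Ret [::]
    else
      tick;;
      let! j := readN r in
      let! I := segments n' j in
      Ret ((j + 1, r) :: I)
  else Ret [::].

(* Argmin over the interval l:r, in the entries l, ..., r of Sol: the stored rotations
   turn the least squares problem with matrix A (for length n) and data f_I into the
   triangular system with matrix R^(n) and right-hand side q^(n)_{1:n}. *)
Definition solve (bk : V) (l r : nat) : P unit :=
  let n := r + 1 - l in
  if n <= k then
    for_each (from_to l r) (fun i => let! x := read (Data, 0, i) in write (Sol, 0, i) x)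
  else
    init_R;;
    init_q l;;
    for_each (index_iota k n) (fun m =>
      update_q l m;;
      extend_R bk m;;
      for_each (from_to 1 (k + 1)) (fun j =>
        let! theta := read (theta_addr m j) in
        eliminate theta m (m - k + j)));;
    for_each (rev (from_to 1 n)) (fun i =>
      let! y := read (q_addr l n i) in
      let! z := fold (from_to (i + 1) (minn (i + k) n)) (fun z j =>
        let! a := read (Rmx, i, j) in
        let! v := read (Sol, 0, l + j - 1) in
        let! av := op (Times a v) in
        op (Minus z av)) y in
      let! d := read (Rmx, i, i) in
      let! v := op (Over z d) in
      write (Sol, 0, l + i - 1) v).

Definition mumford_shah : P (seq (nat * nat)) :=
  let! bk := power beta k in
  precompute bk;;
  dynamic_program;;
  let! I := segments N N in
  for_each I (fun lr => solve bk lr.1 lr.2);;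
  Ret I.

End Algorithm.

Section Output.
Variable R : realType.

Definition algorithm (k N : nat) (beta gamma : R) (f : 'rV[R]_N) :
    seq (nat * nat) * state R :=
  run (mumford_shah beta gamma k N) (initial_state f).

Definition output_signal (k N : nat) (beta gamma : R) (f : 'rV[R]_N) : 'rV[R]_N :=
  \row_(i < N) rmem (algorithm k beta gamma f).2 (Sol, 0, i.+1)%N.

Definition output_intervals (k N : nat) (beta gamma : R) (f : 'rV[R]_N) :
    seq (nat * nat) :=
  (algorithm k beta gamma f).1.

Definition running_time (k N : nat) (beta gamma : R) (f : 'rV[R]_N) : nat :=
  clock (algorithm k beta gamma f).2.

Definition bounds (N : nat) (I : 'I_N * 'I_N) : nat * nat := (I.1.+1, I.2.+1).

(* s lists the intervals of P, each exactly once *)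
Definition lists_partition (N : nat) (s : seq (nat * nat)) (P : {set 'I_N * 'I_N}) :
    bool :=
  perm_eq s (map (@bounds N) (enum P)).

End Output.

(* Main.v *)
(* On an interval, the stored rotations are orthogonal and turn the penalized misfit of v
   into |R v - q|^2 + E, where R is triangular with positive diagonal and E is the sum of
   the squared entries rotated below q. Hence E is the minimum, it is attained by back
   substitution, and it is superadditive under concatenation of intervals (restrict a
   minimizer of the long interval).
   If P*_{l-1} + E^{l:t} >= P*_t, then by superadditivity the left bound l is no better
   than t + 1 for every right bound beyond t, so pruning l is harmless, by descending
   induction on l. Stopping at a candidate l with E^{l:r} + gamma > P*_r is harmless since
   the errors of the smaller left bounds are larger and P* >= 0. So P* + gamma satisfies
   the Bellman equation. Induction on the right ends of the intervals of an arbitrary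
   partition shows that it bounds every functional value from below, and the
   reconstructed pair attains this bound.
   For the running time, a candidate is updated at most N times, and apart from the
   updates each of the N rounds takes constant time per candidate. *)
Require Import Defs.
From mathcomp Require Import all_boot all_order all_algebra reals.
From mathcomp Require Import trigo zify ring lra.
Set Implicit Arguments.
Unset Strict Implicit.
Unset Printing Implicit Defensive.
Import Order.TTheory GRing.Theory Num.Theory.
Local Open Scope ring_scope.

(** * Givens rotations and least squares *)

(** Vectors and matrices are total functions on [nat], indexed from 1, and R^(r) is padded by the
    identity. So extending R^(r) is no step at all, the matrix does not depend on the left bound,
    and no types of varying length occur. A penalized misfit is the squared norm of A v - (f, 0), a
    combination of columns of A minus the data. Columns and data undergo the same rotations, so the
    decomposition follows from norm preservation and linearity of a single rotation, together with
    the triangular shape.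

    Values and time are treated separately. [wp] follows the actual run, and its assertions never
    mention the clock. [cost] lets every read and comparison return anything and only counts
    instructions. The two meet in one fact: the right bounds found by backtracking are at most N,
    which is a consequence of correctness and is needed to bound the cost of solving on the
    intervals. *)

Section Givens.
Variable R : realType.

Definition givens_angle (a b : R) : R :=
  asin (a / (Num.sg b * Num.sqrt (a * a + b * b))).

(** Pivots will stay positive throughout. Then rho is the norm n, the cosine b / n is nonnegative,
    and [asin] recovers the angle from its sine alone. *)
Lemma cos_sin_givens_angle (a b : R) : 0 < b ->
  let n := Num.sqrt (a * a + b * b) in
  [/\ 0 < n, cos (givens_angle a b) = b / n & sin (givens_angle a b) = a / n].
Proof.
move=> b0; rewrite /givens_angle gtr0_sg // mul1r /=.
set n := Num.sqrt _.
have ab0 : 0 < a * a + b * b.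
  by rewrite ltr_wpDl ?mulr_gt0 // -expr2 sqr_ge0.
have n0 : 0 < n by rewrite sqrtr_gt0.
have nn : n ^+ 2 = a * a + b * b by rewrite sqr_sqrtr // ltW.
have bnd : -1 <= a / n <= 1.
  rewrite -ler_norml normrM normfV (gtr0_norm n0) ler_pdivrMr // mul1r.
  by rewrite -sqrtr_sqr ler_wsqrtr // expr2 lerDl mulr_ge0 // ltW.
split => //; last by rewrite asinK // in_itv.
rewrite cos_asin //.
have -> : 1 - (a / n) ^+ 2 = (b / n) ^+ 2.
  rewrite !expr_div_n nn; field.
  by rewrite gt_eqF //= ltr_pwDr // ?sqr_ge0 // exprn_gt0.
by rewrite sqrtr_sqr gtr0_norm // divr_gt0.
Qed.

(** One round of rotations involves the top entries and a single bottom entry, hence a pair instead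
    of a vector of length 2r - k. *)
Definition rotate_entry (theta : R) (i : nat) (st : (nat -> R) * R) : (nat -> R) * R :=
  (fun i' => if i' == i then cos theta * st.1 i + sin theta * st.2 else st.1 i',
   cos theta * st.2 - sin theta * st.1 i).

Fixpoint rotations (theta : nat -> R) (o m : nat) (st : (nat -> R) * R) :=
  if m is m'.+1 then rotate_entry (theta m) (o + m) (rotations theta o m' st) else st.

Lemma rotations_out (theta : nat -> R) (o m : nat) (st : (nat -> R) * R) (i : nat) :
  ~~ (o < i <= o + m)%N -> (rotations theta o m st).1 i = st.1 i.
Proof.
elim: m => //= m IH hi; rewrite -IH; last by lia.
by case: eqP => // ?; lia.
Qed.

Lemma rotations_sqr (theta : nat -> R) (o m n : nat) (st : (nat -> R) * R) :
  (o + m <= n)%N ->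
  \sum_(1 <= i < n.+1) (rotations theta o m st).1 i ^+ 2 + (rotations theta o m st).2 ^+ 2
  = \sum_(1 <= i < n.+1) st.1 i ^+ 2 + st.2 ^+ 2.
Proof.
elim: m => //= m IH hm; rewrite -IH; last by lia.
move: (rotations _ _ _ _) => {IH}-[x y] /=.
set p := (o + m.+1)%N; set t := theta m.+1.
rewrite (bigD1_seq p) ?iota_uniq ?mem_index_iota /=; [|by lia..].
rewrite [in RHS](bigD1_seq p) ?iota_uniq ?mem_index_iota /=; [|by lia..].
rewrite eqxx (eq_bigr (fun i => x i ^+ 2)) => [|i /negPf ->//].
set S := \sum_(i <- _ | _) _.
transitivity ((cos t ^+ 2 + sin t ^+ 2) * (x p ^+ 2 + y ^+ 2) + S); first by ring.
by rewrite cos2Dsin2; ring.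
Qed.

(** Rotations are linear. The combination of states [S c] minus [st'] is modelled on A v minus the
    data. *)
Lemma rotations_comb (theta : nat -> R) (o m n : nat) (v : nat -> R)
    (S : nat -> (nat -> R) * R) (st st' : (nat -> R) * R) :
  (forall i, st.1 i = \sum_(1 <= c < n) v c * (S c).1 i - st'.1 i) ->
  st.2 = \sum_(1 <= c < n) v c * (S c).2 - st'.2 ->
  (forall i, (rotations theta o m st).1 i =
     \sum_(1 <= c < n) v c * (rotations theta o m (S c)).1 i
     - (rotations theta o m st').1 i) /\
  (rotations theta o m st).2 =
     \sum_(1 <= c < n) v c * (rotations theta o m (S c)).2
     - (rotations theta o m st').2.
Proof.
move=> h1 h2; elim: m => //= m [IH1 IH2].
have comb (x y : R) (g h : nat -> R) :
    \sum_(1 <= c < n) v c * (x * g c + y * h c) =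
    x * (\sum_(1 <= c < n) v c * g c) + y * (\sum_(1 <= c < n) v c * h c).
  by rewrite !mulr_sumr -big_split /=; apply: eq_bigr => c _; ring.
split=> [i|].
  case: eqP => _; last exact: IH1.
  rewrite comb IH1 IH2; ring.
under eq_bigr => c _ do rewrite -mulNr.
rewrite comb IH1 IH2; ring.
Qed.

End Givens.

Section LeastSquares.
Variables (R : realType) (k : nat) (bk : R).

Definition diff_coef (j : nat) : R := (-1) ^+ (k - j) * 'C(k, j)%:R.

Definition diff (w : nat -> R) (i : nat) : R := \sum_(j < k.+1) diff_coef j * w (i + j)%N.

(** The truncated [n - k] makes the penalty vanish on intervals of length at most k. *)
Definition itv_cost (f : nat -> R) (l n : nat) (w : nat -> R) : R :=
  \sum_(l <= i < l + n) (w i - f i) ^+ 2 + \sum_(l <= i < l + (n - k)) (bk * diff w i) ^+ 2.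

Lemma itv_cost_ext (f : nat -> R) (l n : nat) (w w' : nat -> R) :
  (forall i, (l <= i < l + n)%N -> w i = w' i) -> itv_cost f l n w = itv_cost f l n w'.
Proof.
move=> h; congr (_ + _); apply: eq_big_nat => i hi; first by rewrite h.
congr ((_ * _) ^+ 2); apply: eq_bigr => j _; rewrite h //.
by have := ltn_ord j; lia.
Qed.

(* The nonzero part of the row appended to the triangular matrix of size r. *)
Definition diff_row (r c : nat) : R :=
  if (r - k < c <= r.+1)%N then bk * diff_coef (c - (r - k).+1) else 0.

(* Columns are the first index, so that each column evolves by [rotations]. *)
Fixpoint tri_steps (r m : nat) (M : nat -> nat -> R) : nat -> (nat -> R) * R :=
  if m is m'.+1 then
    let st := tri_steps r m' M in
    let p := (r - k + m)%N in
    fun c => rotate_entry (givens_angle (st p).2 ((st p).1 p)) p (st c)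
  else fun c => (M c, diff_row r c).

(** R^(r) bordered by the identity. Below size k no rotation takes place, in agreement with R^(k)
    being the identity. *)
Fixpoint tri (r : nat) : nat -> nat -> R :=
  if r is r'.+1 then
    if (r' < k)%N then tri r' else fun c => (tri_steps r' k.+1 (tri r') c).1
  else fun c i => (i == c)%:R.

Definition theta (r m : nat) : R :=
  let p := (r - k + m)%N in
  let st := tri_steps r m.-1 (tri r) p in givens_angle st.2 (st.1 p).

(** Once the angles are fixed, a column evolves independently of the others, exactly as a data
    vector does. *)
Lemma tri_steps_rotations (r m c : nat) :
  tri_steps r m (tri r) c = rotations (theta r) (r - k) m (tri r c, diff_row r c).
Proof. by elim: m => //= m <-. Qed.

(** Here [a] lists the first N entries of a vector and [b r] the entry appended in round r. For the
    data [b] is zero; for A v - (f, 0) it consists of the scaled differences of v. [bot] is what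
    round r leaves at the bottom. *)
Fixpoint top (a b : nat -> R) (r : nat) : nat -> R :=
  if r is r'.+1 then
    if (r' < k)%N then top a b r'
    else (rotations (theta r') (r' - k) k.+1 (top a b r', b r')).1
  else a.

Definition bot (a b : nat -> R) (r : nat) : R :=
  (rotations (theta r) (r - k) k.+1 (top a b r, b r)).2.

Lemma topS (a b : nat -> R) (r : nat) : (k <= r)%N ->
  top a b r.+1 = (rotations (theta r) (r - k) k.+1 (top a b r, b r)).1.
Proof. by move=> kr; rewrite [LHS]/= ltnNge kr. Qed.

Lemma top_small (a b : nat -> R) (r : nat) : (r <= k)%N -> top a b r = a.
Proof. by elim: r => //= r IH hr; rewrite hr IH // ltnW. Qed.

Lemma top_out (a b : nat -> R) (r i : nat) : (r < i)%N -> top a b r i = a i.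
Proof.
elim: r => // r IH hr; case: (ltnP r k) => hk; first by rewrite top_small.
by rewrite topS // rotations_out /= ?IH //; lia.
Qed.

(** Round n acts within the entries up to n + 1, and entry n + 1 is still [a n.+1] before that
    round, so both sides grow by the same two squares. *)
Lemma top_sqr (a b : nat -> R) (n : nat) :
  \sum_(1 <= i < n.+1) top a b n i ^+ 2 + \sum_(k <= r < n) bot a b r ^+ 2
  = \sum_(1 <= i < n.+1) a i ^+ 2 + \sum_(k <= r < n) b r ^+ 2.
Proof.
elim: n => [|n IH]; first by rewrite !big_geq.
case: (ltnP n k) => hn.
  by rewrite [\sum_(k <= r < _) _]big_geq // [in RHS](@big_geq _ _ _ k) // top_small.
rewrite !(@big_nat_recr _ _ _ n k) //= /bot.
have h : (n - k + k.+1 <= n.+1)%N by lia.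
have := rotations_sqr (theta n) (top a b n, b n) h.
rewrite -topS // [RHS]/= [\sum_(1 <= i < n.+2) top a b n i ^+ 2]big_nat_recr //.
rewrite [\sum_(1 <= i < n.+2) a i ^+ 2]big_nat_recr //=.
rewrite (top_out _ _ (ltnSn n)).
set X := \sum_(1 <= i < n.+2) _; set Y := (rotations _ _ _ _).2 => h1.
rewrite addrCA h1.
transitivity (\sum_(1 <= i < n.+1) top a b n i ^+ 2 + \sum_(k <= r < n) bot a b r ^+ 2
  + a n.+1 ^+ 2 + b n ^+ 2); first by rewrite /bot; ring.
by rewrite IH; ring.
Qed.

Lemma top_comb (n : nat) (v f a b : nat -> R) :
  (forall i, a i = \sum_(1 <= c < n) v c * (i == c)%:R - f i) ->
  (forall r, b r = \sum_(1 <= c < n) v c * diff_row r c) ->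
  forall r, (forall i, top a b r i = \sum_(1 <= c < n) v c * tri r c i - top f (fun=> 0) r i)
   /\ bot a b r =
        \sum_(1 <= c < n) v c * (tri_steps r k.+1 (tri r) c).2 - bot f (fun=> 0) r.
Proof.
move=> ha hb r.
have H i : top a b r i = \sum_(1 <= c < n) v c * tri r c i - top f (fun=> 0) r i.
  elim: r i => //= r IH i; case: ifP => _ //.
  have := @rotations_comb R (theta r) (r - k) k.+1 n v
     (fun c => (tri r c, diff_row r c)) (top a b r, b r) (top f (fun=> 0) r, 0) IH.
  rewrite hb /= subr0 => /(_ erefl) [-> _]; congr (_ - _).
  by apply: eq_bigr => c _; rewrite -tri_steps_rotations.
split => //.
have := @rotations_comb R (theta r) (r - k) k.+1 n v
     (fun c => (tri r c, diff_row r c)) (top a b r, b r) (top f (fun=> 0) r, 0) H.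
rewrite /bot hb subr0 => /(_ erefl) [_ ->]; congr (_ - _).
by apply: eq_bigr => c _; rewrite -tri_steps_rotations.
Qed.

(** The invariant of the elimination. The positive diagonal provides the pivots, the band justifies
    the sparse storage, and the last clause is the identity padding. *)
Definition triangular (r : nat) (M : nat -> nat -> R) : Prop :=
  [/\ forall c i, (c < i)%N -> M c i = 0, forall i, 0 < M i i,
      forall c i, (i + k < c)%N -> M c i = 0 &
      forall c i, (r < c)%N -> M c i = (i == c)%:R].

(** A rotation at pivot p changes only the columns p to r + 1, since elsewhere it acts on two zeros.
    Because p + k >= r + 1, no entry outside the band is created. The new pivot is the norm of the
    two rotated entries, hence positive. *)
Lemma triangular_step (r : nat) (M : nat -> nat -> R) (m : nat) :
  (k <= r)%N -> (m <= k.+1)%N -> triangular r M ->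
  let st := tri_steps r m M in
  [/\ triangular r.+1 (fun c => (st c).1),
      forall c, (c <= r - k + m)%N -> (st c).2 = 0 &
      forall c, (r.+1 < c)%N -> (st c).2 = 0].
Proof.
move=> kr; elim: m => [|m IH] hm [M1 M2 M3 M4] /=.
  split.
  - by split => //= c i hc; apply: M4; lia.
  - by move=> c hc; rewrite /diff_row ifF //; lia.
  - by move=> c hc; rewrite /diff_row ifF //; lia.
case: (IH (ltnW hm) (And4 M1 M2 M3 M4)) => -[T1 T2 T3 T4] B1 B2.
move: (tri_steps r m M) T1 T2 T3 T4 B1 B2 => st T1 T2 T3 T4 B1 B2.
set p := (r - k + m.+1)%N.
have [n0 hc hs] := cos_sin_givens_angle (st p).2 (T2 p).
have ps : p = (r - k + m).+1 by rewrite /p addnS.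
move: (givens_angle _ _) hc hs => t hc hs.
have nn : Num.sqrt ((st p).2 * (st p).2 + (st p).1 p * (st p).1 p) ^+ 2 =
    (st p).2 * (st p).2 + (st p).1 p * (st p).1 p.
  by rewrite sqr_sqrtr // addr_ge0 // -expr2 sqr_ge0.
move: (Num.sqrt _) n0 nn hc hs => n n0 nn hc hs.
have zero c : (c < p)%N || (r.+1 < c)%N -> (st c).1 p = 0 /\ (st c).2 = 0.
  case/orP=> h; first by rewrite T1 // B1 //; lia.
  by rewrite T4 // B2 //; case: eqP => //; lia.
split.
- split => /= [c i ci|i|c i ci|c i hcr].
  + case: eqP => [ip|_]; last exact: T1.
    by have [|-> ->] := zero c; rewrite ?mulr0 ?addr0 //; lia.
  + case: eqP => [->|_]; last exact: T2.
    rewrite hc hs.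
    have -> : (st p).1 p / n * (st p).1 p + (st p).2 / n * (st p).2 = n.
      by apply: (mulIf (lt0r_neq0 n0)); rewrite -expr2 nn; field; rewrite gt_eqF.
    by [].
  + case: eqP => [ip|_]; last exact: T3.
    have [|-> ->] := zero c; last by rewrite !mulr0 addr0.
    by lia.
  + case: eqP => [ip|_]; last exact: T4.
    have [|-> ->] := zero c; first by rewrite hcr orbT.
    by rewrite !mulr0 addr0; case: eqP => //; lia.
- move=> c cp /=; case: (ltngtP c p) cp => // [cp _|-> _].
    by have [|-> ->] := zero c; rewrite ?cp // !mulr0 subr0.
  by rewrite hc hs; field; rewrite gt_eqF.
- move=> c hcr; have [|-> ->] := zero c; first by rewrite hcr orbT.
  by rewrite !mulr0 subr0.
Qed.

Lemma tri_triangular (r : nat) : triangular r (tri r).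
Proof.
elim: r => [|r IH] /=.
  split => //= [c i ci|i|c i ci]; rewrite ?eqxx //; case: eqP => //; lia.
case: ltnP => hr; last by case: (triangular_step hr (leqnn _) IH).
by case: IH => h1 h2 h3 h4; split => // c i hc; apply: h4; lia.
Qed.

Lemma tri_steps_bot (r c : nat) : (k <= r)%N -> (tri_steps r k.+1 (tri r) c).2 = 0.
Proof.
move=> kr; case: (triangular_step kr (leqnn _) (tri_triangular r)) => _ h1 h2.
by case: (leqP c r.+1) => h; [apply: h1; lia|apply: h2].
Qed.

Definition rhs (f : nat -> R) (l : nat) : nat -> nat -> R :=
  top (fun i => f (l + i - 1)%N) (fun=> 0).

Definition resid (f : nat -> R) (l r : nat) : R :=
  bot (fun i => f (l + i - 1)%N) (fun=> 0) r.

(** The sum that the error update accumulates. That it is the minimum of [itv_cost] is the content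
    of [itv_error_le_cost] and [itv_error_attained]. *)
Definition itv_error (f : nat -> R) (l n : nat) : R :=
  \sum_(k <= r < n) resid f l r ^+ 2.

(* The rotations preserve the norm and, by the choice of the angles, clear the appended
   rows of the matrix; what they leave at the bottom is the residual. *)
Lemma itv_cost_tri (f : nat -> R) (l n : nat) (w : nat -> R) :
  itv_cost f l n w =
  \sum_(1 <= i < n.+1)
     (\sum_(1 <= c < n.+1) tri n c i * w (l + c - 1)%N - rhs f l n i) ^+ 2
  + itv_error f l n.
Proof.
pose v c := w (l + c - 1)%N.
pose g i := f (l + i - 1)%N.
pose a i := \sum_(1 <= c < n.+1) v c * (i == c)%:R - g i.
pose b r := \sum_(1 <= c < n.+1) v c * diff_row r c.
have H := top_comb (fun=> erefl : a _ = _) (fun=> erefl : b _ = _).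
have aE i : (1 <= i < n.+1)%N -> a i = v i - g i.
  move=> hi; rewrite /a (bigD1_seq i) ?mem_index_iota ?iota_uniq //= eqxx mulr1.
  by rewrite big1 ?addr0 // => c ci; rewrite eq_sym (negPf ci) mulr0.
(* The row of round r is supported on the columns r - k + 1 to r + 1, so the sum is cut before and
   after this band. *)
have bE r : (k <= r < n)%N -> b r = bk * diff w (l + r - k)%N.
  move=> hr; rewrite /b (big_cat_nat (n := (r - k).+1)) //=; [|lia].
  rewrite big_nat big1 ?add0r; last first.
    by move=> c hc; rewrite /diff_row ifF ?mulr0 //; lia.
  rewrite (big_cat_nat (n := r.+2)) //=; [|lia..].
  rewrite [X in _ + X]big_nat [X in _ + X]big1 ?addr0; last first.
    by move=> c hc; rewrite /diff_row ifF ?mulr0 //; lia.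
  rewrite -{1}[(r - k).+1]add0n big_addn /diff mulr_sumr.
  have -> : (r.+2 - (r - k).+1 = k.+1)%N by lia.
  rewrite big_mkord; apply: eq_bigr => j _.
  have := ltn_ord j => hj.
  rewrite /diff_row ifT; last by lia.
  rewrite /v mulrC mulrA.
  have -> : (j + (r - k).+1 - (r - k).+1 = j)%N by lia.
  by congr (_ * w _); lia.
rewrite /itv_cost.
have -> : \sum_(l <= i < l + n) (w i - f i) ^+ 2 = \sum_(1 <= i < n.+1) a i ^+ 2.
  rewrite -[X in \sum_(X <= _ < _) _]add0n big_addn addKn -[in RHS](add0n 1%N) big_addn subn1 /=.
  apply: eq_big_nat => i hi; rewrite aE; last by lia.
  by rewrite /v /g (_ : (l + (i + 1) - 1 = i + l)%N) //; lia.
have -> : \sum_(l <= i < l + (n - k)) (bk * diff w i) ^+ 2 = \sum_(k <= r < n) b r ^+ 2.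
  rewrite -[X in \sum_(X <= _ < _) _]add0n big_addn addKn -[k in RHS]add0n big_addn.
  apply: eq_big_nat => i hi; rewrite bE; last by lia.
  by rewrite (_ : (l + (i + k) - k = i + l)%N) //; lia.
rewrite -top_sqr; congr (_ + _).
  apply: eq_bigr => i _; case: (H n) => -> _; congr ((_ - _) ^+ 2).
  by apply: eq_bigr => c _; rewrite mulrC.
(* At the bottom all columns have been cleared, so what remains is the negative of the data
   residual, whatever w is. *)
apply: eq_big_nat => r hr; case: (H r) => _ ->.
rewrite big1 ?add0r ?sqrrN // => c _.
by rewrite tri_steps_bot ?mulr0 //; lia.
Qed.

Lemma itv_error_small (f : nat -> R) (l n : nat) : (n <= k)%N -> itv_error f l n = 0.
Proof. by move=> h; rewrite /itv_error big_geq. Qed.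

Lemma itv_error_ge0 (f : nat -> R) (l n : nat) : 0 <= itv_error f l n.
Proof. by apply: sumr_ge0 => r _; apply: sqr_ge0. Qed.

Lemma itv_error_le_cost (f : nat -> R) (l n : nat) (w : nat -> R) :
  itv_error f l n <= itv_cost f l n w.
Proof. by rewrite itv_cost_tri lerDr sumr_ge0 // => i _; apply: sqr_ge0. Qed.

Definition solves (f : nat -> R) (l n i : nat) (w : nat -> R) : Prop :=
  \sum_(1 <= c < n.+1) tri n c i * w (l + c - 1)%N = rhs f l n i.

Lemma itv_cost_solves (f : nat -> R) (l n : nat) (w : nat -> R) :
  (forall i, (1 <= i <= n)%N -> solves f l n i w) -> itv_cost f l n w = itv_error f l n.
Proof.
move=> h; rewrite itv_cost_tri big_nat big1 ?add0r // => i hi.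
by rewrite h // subrr expr0n.
Qed.

(** Shape and band reduce row i to the diagonal term and the terms that the inner loop of [solve]
    subtracts. *)
Lemma tri_row_sum (n i : nat) (x : nat -> R) : (1 <= i <= n)%N ->
  \sum_(1 <= c < n.+1) tri n c i * x c =
  tri n i i * x i + \sum_(i.+1 <= c < (minn (i + k) n).+1) tri n c i * x c.
Proof.
case: (tri_triangular n) => T1 _ T3 _ hi.
rewrite (big_cat_nat (n := i)) //=; [|lia|lia].
rewrite big_nat big1 ?add0r; last by move=> c hc; rewrite T1 ?mul0r //; lia.
rewrite big_ltn; last by lia.
congr (_ + _).
rewrite (big_cat_nat (n := (minn (i + k) n).+1)) //=; [|lia|lia].
rewrite [X in _ + X]big_nat [X in _ + X]big1 ?addr0 // => c hc.
by rewrite T3 ?mul0r //; lia.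
Qed.

Lemma solves_ex (f : nat -> R) (l n : nat) : (0 < l)%N ->
  exists w, forall i, (1 <= i <= n)%N -> solves f l n i w.
Proof.
move=> l0.
(* Back substitution: the last m equations are solved, and the next unknown does not occur in
   them. *)
suff H m : exists w, forall i, (1 <= i <= n)%N -> (n - m < i)%N -> solves f l n i w.
  by case: (H n) => w hw; exists w => i hi; apply: hw => //; lia.
elim: m => [|m [w hw]]; first by exists (fun=> 0) => i; lia.
case: (leqP n m) => hm; first by exists w => i hi hi'; apply: hw => //; lia.
case: (tri_triangular n) => _ /(_ (n - m)%N) T2 _ _.
pose i0 := (n - m)%N; have i0E : i0 = (n - m)%N by [].
pose S := \sum_(i0.+1 <= c < (minn (i0 + k) n).+1) tri n c i0 * w (l + c - 1)%N.
pose w' j := if j == (l + i0 - 1)%N then (rhs f l n i0 - S) / tri n i0 i0 else w j.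
have w'E c : (i0 < c)%N -> w' (l + c - 1)%N = w (l + c - 1)%N.
  by move=> hc; rewrite /w'; case: eqP => //; lia.
have tail i (hi : (1 <= i <= n)%N) (h0 : (i0 <= i)%N) :
  \sum_(i.+1 <= c < (minn (i + k) n).+1) tri n c i * w' (l + c - 1)%N =
  \sum_(i.+1 <= c < (minn (i + k) n).+1) tri n c i * w (l + c - 1)%N.
  by apply: eq_big_nat => c hc; rewrite w'E //; lia.
exists w' => i hi hi'; rewrite /solves tri_row_sum // tail //; last by lia.
case: (ltngtP i0 i) => [h|h|h]; [|lia|].
  by rewrite w'E // -(tri_row_sum (fun c => w (l + c - 1)%N)) //; apply: hw => //; lia.
rewrite -h /w' eqxx -/S.
by rewrite mulrC divfK ?subrK // gt_eqF.
Qed.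

Lemma itv_error_attained (f : nat -> R) (l n : nat) : (0 < l)%N ->
  exists w, itv_cost f l n w = itv_error f l n.
Proof.
by move=> l0; have [w hw] := solves_ex f n l0; exists w; apply: itv_cost_solves.
Qed.

Lemma itv_error_superadditive (f : nat -> R) (l m n : nat) : (0 < l)%N ->
  itv_error f l m + itv_error f (l + m) n <= itv_error f l (m + n).
Proof.
move=> l0; have [w <-] := itv_error_attained f (m + n) l0.
apply: (@le_trans _ _ (itv_cost f l m w + itv_cost f (l + m) n w)).
  by apply: lerD; apply: itv_error_le_cost.
rewrite /itv_cost addrACA.
rewrite -big_cat_nat /=; [|lia|lia].
rewrite addnA lerD2l.
have sub0 a b : 0 <= \sum_(a <= i < b) (bk * diff w i) ^+ 2.
  by apply: sumr_ge0 => i _; apply: sqr_ge0.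
(* The penalty of the union has in addition the differences straddling the cut, a nonnegative
   surplus. For n <= k the right interval contributes no differences, and the range of the union may
   end before l + m. *)
case: (leqP n k) => hn.
  rewrite [X in _ + X]big_geq ?addr0; last by lia.
  by rewrite [leRHS](big_cat_nat (n := (l + (m - k))%N)) /= ?lerDl //; lia.
rewrite [leRHS](big_cat_nat (n := (l + m)%N)) /=; [|lia|lia].
have -> : (l + (m + n - k) = l + m + (n - k))%N by lia.
rewrite lerD2r [leRHS](big_cat_nat (n := (l + (m - k))%N)) /= ?lerDl //; lia.
Qed.

End LeastSquares.

(** * Partitions and the Bellman equation *)

Section Intervals.

(** The intervals are listed from right to left, the order in which backtracking emits them. *)
Fixpoint chain (r : nat) (s : seq (nat * nat)) : bool :=
  if s is (l, r') :: s' then [&& r' == r, (0 < l <= r)%N & chain l.-1 s'] else r == 0%N.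

Lemma chain_mem (r : nat) (s : seq (nat * nat)) (I : nat * nat) :
  chain r s -> I \in s -> (0 < I.1 <= I.2)%N && (I.2 <= r)%N.
Proof.
elim: s r => //= -[l r'] s IH r /and3P[/eqP -> lr cs].
rewrite inE => /orP[/eqP ->/=|/(IH _ cs)]; first by rewrite lr leqnn.
by move: lr; lia.
Qed.

Lemma chain_cover (r : nat) (s : seq (nat * nat)) (x : nat) :
  chain r s -> (0 < x <= r)%N -> exists2 I, I \in s & (I.1 <= x <= I.2)%N.
Proof.
elim: s r => [|[l r'] s IH] r /=; first by move/eqP->; lia.
move=> /and3P[/eqP -> lr cs] xr.
case: (leqP l x) => lx; first by exists (l, r); rewrite ?mem_head //= lx; lia.
have [|I Is hI] := IH _ cs; first by lia.
by exists I => //; rewrite inE Is orbT.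
Qed.

Lemma chain_disjoint (r : nat) (s : seq (nat * nat)) (I I' : nat * nat) (x : nat) :
  chain r s -> I \in s -> I' \in s ->
  (I.1 <= x <= I.2)%N -> (I'.1 <= x <= I'.2)%N -> I = I'.
Proof.
elim: s r => //= -[l r'] s IH r /and3P[/eqP -> lr cs].
rewrite !inE => /orP[/eqP ->|Is] /orP[/eqP ->|Is'] //=; last exact: IH cs Is Is'.
  by have := chain_mem cs Is'; lia.
by have := chain_mem cs Is; lia.
Qed.

Lemma chain_uniq (r : nat) (s : seq (nat * nat)) : chain r s -> uniq s.
Proof.
elim: s r => //= -[l r'] s IH r /and3P[/eqP -> lr cs].
rewrite (IH _ cs) andbT; apply/negP => /(chain_mem cs) /=; lia.
Qed.

Lemma itv_partitionP (N : nat) (P : {set 'I_N * 'I_N}) :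
  reflect [/\ forall I, I \in P -> (I.1 <= I.2)%N,
              forall I I' (x : 'I_N), I \in P -> I' \in P ->
                (I.1 <= x <= I.2)%N -> (I'.1 <= x <= I'.2)%N -> I = I' &
              forall x : 'I_N, exists2 I, I \in P & (I.1 <= x <= I.2)%N]
    (itv_partition P).
Proof.
have bE (I : 'I_N * 'I_N) x : (x \in block I) = (I.1 <= x <= I.2)%N by rewrite inE.
apply: (iffP and3P) => [[/eqP cov /trivIsetP triv n0]|[h1 h2 h3]].
  have le I : I \in P -> (I.1 <= I.2)%N.
    move=> IP; rewrite leqNgt; apply/negP => lt; case/imsetP: n0.
    exists I => //; apply/setP => x; rewrite bE inE; apply/esym/negP.
    by move=> /andP[h1 /(leq_trans h1)]; rewrite leqNgt lt.
  split=> // [I I' x IP IP' hx hx'|x].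
    have eqb : block I = block I'.
      apply/eqP/negPn/negP => ne.
      have := triv _ _ (imset_f _ IP) (imset_f _ IP') ne.
      by move/disjoint_setI0/setP/(_ x); rewrite in_setI !bE hx hx' inE.
    have := le _ IP; have := le _ IP'.
    (* Equal nonempty blocks contain each other's end points, which forces equal bounds. *)
    have /setP e := eqb.
    have := e I.1; have := e I.2; have := e I'.1; have := e I'.2.
    rewrite !bE !leqnn.
    case: I I' {hx hx' IP IP' eqb e} => a b [a' b'] /= *.
    by congr (_, _); apply: val_inj => /=; lia.
  have : x \in cover [set block I | I in P] by rewrite cov inE.
  by case/bigcupP => _ /imsetP[I IP ->]; rewrite bE => hx; exists I.
split.
- apply/eqP/setP => x; rewrite inE; have [I IP hx] := h3 x.
  by apply/bigcupP; exists (block I); [apply: imset_f|rewrite bE].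
- apply/trivIsetP => _ _ /imsetP[I IP ->] /imsetP[I' IP' ->] ne.
  apply/pred0Pn => -[x /= /andP[]]; rewrite !bE => hx hx'.
  by case/eqP: ne; rewrite (h2 _ _ _ IP IP' hx hx').
- apply/imsetP => -[I IP /setP /(_ I.1)]; rewrite bE inE leqnn /=.
  by rewrite (h1 _ IP).
Qed.

End Intervals.

Section Bellman.
Variables (R : realType) (k N : nat) (beta gamma : R) (f : 'rV[R]_N).

(* Entries are numbered from 1, and are 0 outside of 1:N. *)
Definition entry (v : 'rV[R]_N) (i : nat) : R :=
  if i is i'.+1 then if insub i' is Some j then v 0 j else 0 else 0.

Lemma entryE (v : 'rV[R]_N) (i : 'I_N) : entry v i.+1 = v 0 i.
Proof. by rewrite /entry insubT //= => h; congr (v _ _); apply: val_inj. Qed.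

Local Notation bk := (beta ^+ k).
Local Notation E l r := (itv_error k bk (entry f) l (r.+1 - l)).

Definition penalty (u : 'rV[R]_N) (I : nat * nat) : R :=
  \sum_(I.1 <= i < I.1 + (I.2.+1 - I.1 - k)) (bk * diff k (entry u) i) ^+ 2.

Definition misfit (u : 'rV[R]_N) (i : nat) : R := (entry u i - entry f i) ^+ 2.

Lemma itv_costE (u : 'rV[R]_N) (I : nat * nat) : (I.1 <= I.2)%N ->
  itv_cost k bk (entry f) I.1 (I.2.+1 - I.1) (entry u) =
  \sum_(I.1 <= i < I.2.+1) misfit u i + penalty u I.
Proof. by move=> h; rewrite /itv_cost subnKC // ltnW. Qed.

Lemma penalty_ge0 (u : 'rV[R]_N) (I : nat * nat) : 0 <= penalty u I.
Proof. by apply: sumr_ge0 => i _; apply: sqr_ge0. Qed.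

Lemma penaltyE (u : 'rV[R]_N) (I : 'I_N * 'I_N) : (I.1 <= I.2)%N ->
  beta ^+ (2 * k) * sqnorm (nabla k (subvector u I)) = penalty u (bounds I).
Proof.
move=> le; rewrite /penalty /bounds /= subSS [in RHS]subSn //.
rewrite -[X in \sum_(X <= _ < _) _]add0n big_addn addKn big_mkord /sqnorm mulr_sumr.
apply: eq_bigr => i _; rewrite exprMn mulnC exprM; congr (_ * _ ^+ 2).
rewrite mxE /diff; apply: eq_bigr => j _; congr (_ * _).
rewrite mxE -entryE; congr (entry u _) => /=; lia.
Qed.

Lemma functionalE (u : 'rV[R]_N) (P : {set 'I_N * 'I_N}) : itv_partition P ->
  functional k beta gamma f u P =
  \sum_(1 <= i < N.+1) misfit u i + \sum_(I in P) (penalty u (bounds I) + gamma).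
Proof.
move=> /itv_partitionP [le _ _]; rewrite /functional big_split /= addrA.
congr (_ + _ + _).
- rewrite big_add1 big_mkord.
  by apply: eq_bigr => i _; rewrite !mxE /misfit !entryE.
- by apply: eq_bigr => I IP; rewrite penaltyE // le.
- by rewrite sumr_const mulr_natr.
Qed.

(* B r is the minimal value for the data f_{1:r}, that is P*_r + gamma. *)
Definition bellman_le (B : nat -> R) : Prop :=
  forall l r, (0 < l <= r)%N -> (r <= N)%N -> B r <= B l.-1 + E l r + gamma.

Lemma bellman_le_functional (B : nat -> R) (u : 'rV[R]_N) (P : {set 'I_N * 'I_N}) :
  0 < gamma -> B 0%N = 0 -> bellman_le B -> itv_partition P -> B N <= functional k beta gamma f u P.
Proof.
move=> gamma_gt0 B0 hB hP; rewrite functionalE //.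
have /itv_partitionP [le inj cov] := hP.
(* The functional restricted to 1:r. It is compared with B only where an interval of P ends, so that
   no interval is cut. *)
pose G r := \sum_(1 <= i < r.+1) misfit u i +
  \sum_(I in P | (I.2 < r)%N) (penalty u (bounds I) + gamma).
have claim r : (r == 0%N) || [exists I in P, I.2.+1 == r] -> B r <= G r.
  elim/ltn_ind: r => r IH /orP[/eqP ->|/exists_inP[[a b] IP /eqP /= Ir]].
    by rewrite B0 /G big_geq // add0r sumr_ge0 // => I _; rewrite addr_ge0 ?penalty_ge0 // ltW.
  have /= leI := le _ IP.
  (* The interval containing the predecessor of a ends there: otherwise it would also contain a,
     hence equal (a, b), which starts at a. *)
  have hl : (a == 0%N :> nat) || [exists I' in P, I'.2.+1 == a].
    case: (posnP a) => [->//|a0] /=.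
    have h : (a.-1 < N)%N by have := ltn_ord a; lia.
    have [[a' b'] IP' /= hI'] := cov (Ordinal h).
    apply/exists_inP; exists (a', b') => //=; apply/eqP.
    case: (leqP a b') => h2; last by lia.
    have := inj (a, b) (a', b') a IP IP'; rewrite /= leqnn leI /= => /(_ isT) e.
    have [eqa _] : (a, b) = (a', b') by apply: e; lia.
    by move: hI'; rewrite -eqa; lia.
  have lt : (a < r)%N by lia.
  have := IH _ lt hl.
  have h1 : (0 < a.+1 <= r)%N by [].
  have h2 : (r <= N)%N by have := ltn_ord b; lia.
  have := hB _ _ h1 h2; rewrite /= => hr hl'.
  apply: (le_trans hr).
  have eqr : \sum_(1 <= i < r.+1) misfit u i =
     \sum_(1 <= i < a.+1) misfit u i + \sum_(a.+1 <= i < r.+1) misfit u i.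
    by rewrite -big_cat_nat //=; lia.
  have cst : E a.+1 r <= \sum_(a.+1 <= i < r.+1) misfit u i + penalty u (bounds (a, b)).
    have := itv_error_le_cost k bk (entry f) a.+1 (r.+1 - a.+1) (entry u).
    by rewrite -Ir; have /= -> := @itv_costE u (bounds (a, b)) leI.
  have pens : \sum_(J in P | (J.2 < a)%N) (penalty u (bounds J) + gamma) +
      (penalty u (bounds (a, b)) + gamma) <=
      \sum_(J in P | (J.2 < r)%N) (penalty u (bounds J) + gamma).
    rewrite [leRHS](bigD1 (a, b)) /=; last by rewrite IP -Ir ltnS /=.
    rewrite [leLHS]addrC lerD2l big_mkcond [leRHS]big_mkcond /=; apply: ler_sum => -[c d] _ /=.
    have J0 : 0 <= penalty u (bounds (c, d)) + gamma by rewrite addr_ge0 ?penalty_ge0 // ltW.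
    case: ifP => [/andP[-> hJ]|_]; last by case: ifP.
    rewrite ifT //=; apply/andP; split; first by lia.
    by apply/eqP => -[_ e]; move: hJ; rewrite e; lia.
  by rewrite /G eqr; move: hl' cst pens; rewrite /G; lra.
have -> : \sum_(I in P) (penalty u (bounds I) + gamma) =
    \sum_(I in P | (I.2 < N)%N) (penalty u (bounds I) + gamma).
  by apply: eq_bigl => J; rewrite ltn_ord andbT.
apply: claim; case: (posnP N) => [/eqP e|N0]; apply/orP; [by left|right].
have h : (N.-1 < N)%N by rewrite prednK.
have [[a b] IP /= hI] := cov (Ordinal h).
apply/exists_inP; exists (a, b) => //=.
by have := ltn_ord b; lia.
Qed.

(** The counterpart of [bellman_le_functional]: equality in the Bellman inequality along a chain,
    with the minimal cost on each interval, telescopes to B N. *)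
Lemma chain_functional (B : nat -> R) (u : 'rV[R]_N) (s : seq (nat * nat)) :
  B 0%N = 0 -> chain N s ->
  (forall I, I \in s -> B I.2 = B I.1.-1 + E I.1 I.2 + gamma) ->
  (forall I, I \in s ->
     itv_cost k bk (entry f) I.1 (I.2.+1 - I.1) (entry u) = E I.1 I.2) ->
  exists P : {set 'I_N * 'I_N},
    [/\ lists_partition s P, itv_partition P & functional k beta gamma f u P = B N].
Proof.
move=> B0 cs hB hE; pose P := [set I : 'I_N * 'I_N | bounds I \in s].
have binj : injective (@bounds N).
  by case=> a b [a' b'] [] /val_inj -> /val_inj ->.
have lP : lists_partition s P.
  apply: uniq_perm; first exact: chain_uniq cs.
    by rewrite map_inj_uniq ?enum_uniq.
  move=> I; apply/idP/mapP => [Is|[J]]; last by rewrite mem_enum inE => h ->.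
  have := chain_mem cs Is; case: I Is => l r /= Is hI.
  have hl : (l.-1 < N)%N by lia.
  have hr : (r.-1 < N)%N by lia.
  have e : (l, r) = bounds (Ordinal hl, Ordinal hr).
    by rewrite /bounds /= !prednK //; lia.
  by exists (Ordinal hl, Ordinal hr) => //; rewrite mem_enum inE -e.
have pP : itv_partition P.
  apply/itv_partitionP; split.
  - by move=> I; rewrite inE => /(chain_mem cs) /= /andP[]; rewrite ltnS.
  - move=> I I' x; rewrite !inE => Is Is' h h'; apply: binj.
    by apply: (chain_disjoint cs Is Is' (x := x.+1)).
  - move=> x; have [|J Js hJ] := chain_cover (x := x.+1) cs; first by rewrite ltn_ord.
    move: (lP) => /perm_mem /(_ J); rewrite Js => /esym /mapP [I IP JE].
    by exists I; [rewrite -mem_enum|move: hJ; rewrite JE].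
exists P; split => //; rewrite functionalE //.
have -> : \sum_(I in P) (penalty u (bounds I) + gamma) =
    \sum_(I <- s) (penalty u I + gamma).
  by rewrite (perm_big _ lP) /= big_map big_enum.
(* Only the right end of the chain is generalized from N to r; the signals keep their length. *)
elim: s (N : nat) cs hB hE {P lP pP binj} => [|[l r'] s IH] r /=.
  by move=> /eqP -> _ _; rewrite big_geq // big_nil addr0.
move=> /and3P[/eqP -> /andP[l0 lr] cs] hB hE.
have /= hBl := hB _ (mem_head _ _).
have /= hEl := hE _ (mem_head _ _).
have := IH _ cs; rewrite prednK // => IH'.
rewrite big_cons hBl -hEl -[X in itv_cost _ _ _ X _ _]/((l, r).1) itv_costE //= -IH'.
- rewrite (big_cat_nat (n := l)) //=; last by lia.
  by ring.
- by move=> I Is; apply: hB; rewrite inE Is orbT.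
- by move=> I Is; apply: hE; rewrite inE Is orbT.
Qed.

End Bellman.

(** * Correctness of the program *)

Section ProgramLogic.
Variable R : realType.

Definition wp (A : Type) (p : prog R A) (Q : A -> state R -> Prop) (s : state R) : Prop :=
  Q (run p s).1 (run p s).2.

Lemma run_bind (A B : Type) (p : prog R A) (g : A -> prog R B) (s : state R) :
  run (bind p g) s = run (g (run p s).1) (run p s).2.
Proof. by elim: p s => /=. Qed.

Lemma wp_bind (A B : Type) (p : prog R A) (g : A -> prog R B)
    (Q : B -> state R -> Prop) (s : state R) :
  wp p (fun a => wp (g a) Q) s -> wp (bind p g) Q s.
Proof. by rewrite /wp run_bind. Qed.

Lemma wp_mono (A : Type) (p : prog R A) (Q Q' : A -> state R -> Prop) (s : state R) :
  wp p Q s -> (forall a s', Q a s' -> Q' a s') -> wp p Q' s.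
Proof. by move=> h; apply. Qed.

Section Instructions.
Variables (B : Type) (Q : B -> state R -> Prop) (s : state R).

Lemma wp_op (o : operation R) (g : R -> prog R B) :
  wp (g (eval o)) Q (step s) -> wp (bind (op o) g) Q s.
Proof. by []. Qed.

Lemma wp_leq (x y : R) (g : bool -> prog R B) :
  wp (g (x <= y)) Q (step s) -> wp (bind (leq_real x y) g) Q s.
Proof. by []. Qed.

Lemma wp_read (a : addr) (g : R -> prog R B) :
  wp (g (rmem s a)) Q (step s) -> wp (bind (read R a) g) Q s.
Proof. by []. Qed.

Lemma wp_write (a : addr) (x : R) (g : unit -> prog R B) :
  wp (g tt) Q (step (store a x s)) -> wp (bind (write a x) g) Q s.
Proof. by []. Qed.

Lemma wp_readN (i : nat) (g : nat -> prog R B) :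
  wp (g (nmem s i)) Q (step s) -> wp (bind (readN R i) g) Q s.
Proof. by []. Qed.

Lemma wp_writeN (i n : nat) (g : unit -> prog R B) :
  wp (g tt) Q (step (storeN i n s)) -> wp (bind (writeN R i n) g) Q s.
Proof. by []. Qed.

Lemma wp_tick (g : unit -> prog R B) :
  wp (g tt) Q (step s) -> wp (bind (tick R) g) Q s.
Proof. by []. Qed.

Lemma wp_ret (b : B) : Q b s -> wp (Ret b) Q s.
Proof. by []. Qed.

End Instructions.

(** The invariant is indexed by the next value of the loop variable. The final index is [maxn a b]
    because an empty range leaves it at a. *)
Lemma wp_fold (A : Type) (I : nat -> A -> state R -> Prop) (a b : nat)
    (body : A -> nat -> prog R A) (acc : A) (s : state R) :
  I a acc s ->
  (forall i acc s, (a <= i < b)%N -> I i acc s -> wp (body acc i) (I i.+1) (step s)) ->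
  wp (fold (index_iota a b) body acc) (I (maxn a b)) s.
Proof.
rewrite /index_iota => h0 hI.
case: (leqP a b) => ab; last first.
  by rewrite (_ : (b - a = 0)%N) /=; [rewrite /wp /=|lia].
have [d bE] : exists d, b = (a + d)%N by exists (b - a)%N; rewrite subnKC.
subst b; rewrite addKn.
elim: d a acc s {ab} h0 hI => [|d IH] a acc s h0 hI /=.
  by rewrite addn0.
change (wp (bind (body acc a) (fold (iota a.+1 d) body)) (I (a + d.+1)%N) (step s)).
apply: wp_bind; apply: (wp_mono (hI a acc s _ h0)); first by lia.
move=> acc' s' h; rewrite addnS -addSn; apply: IH => // i acc'' s'' hi.
by apply: hI; lia.
Qed.

Lemma wp_for_each (I : nat -> state R -> Prop) (a b : nat)
    (body : nat -> prog R unit) (s : state R) :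
  I a s ->
  (forall i s, (a <= i < b)%N -> I i s -> wp (body i) (fun=> I i.+1) (step s)) ->
  wp (for_each (index_iota a b) body) (fun=> I (maxn a b)) s.
Proof.
move=> h0 hI; apply: (@wp_fold unit (fun i _ => I i)) => // i _ s'; exact: hI.
Qed.

(** Frame condition for writes within W. The clock is left out, so that each [step] is invisible to
    it. *)
Definition same_outside (W : pred addr) (s s' : state R) : Prop :=
  (forall a, ~~ W a -> rmem s' a = rmem s a) /\ nmem s' = nmem s.

Lemma same_outside_trans (W W' W'' : pred addr) (s s' s'' : state R) :
  subpred W W'' -> subpred W' W'' ->
  same_outside W s s' -> same_outside W' s' s'' -> same_outside W'' s s''.
Proof.
move=> h h' [m n] [m' n']; split=> [a ha|]; last by rewrite n' n.
rewrite m' ?m //; apply: contra ha; [exact: h|exact: h'].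
Qed.

Lemma wp_rotate (theta : R) (x y : addr) (s : state R) : x != y ->
  wp (rotate theta x y) (fun=> fun s' =>
    [/\ rmem s' x = cos theta * rmem s x + sin theta * rmem s y,
        rmem s' y = cos theta * rmem s y - sin theta * rmem s x,
        forall a, a != x -> a != y -> rmem s' a = rmem s a & nmem s' = nmem s]) s.
Proof.
move=> /negPf xy; rewrite /wp /=; split => //.
- by rewrite xy eqxx.
- by rewrite eqxx.
- by move=> a /negPf ax /negPf ay; rewrite ay ax.
Qed.
End ProgramLogic.

(** * Matrix subroutines of the program *)

Section Rotations.
Variables (R : realType) (k N : nat) (beta : R).
Local Notation bk := (beta ^+ k).

Lemma wp_power (x : R) (n : nat) (s : state R) :
  wp (power x n) (fun y s' => y = x ^+ n /\ same_outside xpred0 s s') s.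
Proof.
rewrite /power; apply: wp_op.
have := @wp_fold R R (fun i y s' => y = x ^+ i.-1 /\ same_outside xpred0 s s') 1 n.+1.
rewrite (maxn_idPr _) // => h; apply: (h); first by [].
move=> i y s' hi [-> hs]; rewrite /wp /=; split => //.
by case: i hi => // i _; rewrite /= exprSr.
Qed.

Lemma wp_init_R (s : state R) :
  wp (init_R R k) (fun _ s' =>
    (forall i j, (1 <= i <= k)%N -> (1 <= j <= k)%N -> rmem s' (Rmx, i, j) = (i == j)%:R)
    /\ same_outside (fun a => a.1.1 == Rmx) s s') s.
Proof.
have := @wp_for_each R (fun i s' =>
   (forall i' j, (1 <= i' < i)%N -> (1 <= j <= k)%N -> rmem s' (Rmx, i', j) = (i' == j)%:R)
    /\ same_outside (fun a => a.1.1 == Rmx) s s') 1 k.+1.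
rewrite (maxn_idPr _) // => h; apply: h; first by split => // i j; lia.
move=> i s1 hi [h1 h2].
have := @wp_for_each R (fun j s' =>
   [/\ forall i' j, (1 <= i' < i)%N -> (1 <= j <= k)%N -> rmem s' (Rmx, i', j) = (i' == j)%:R,
     forall j', (1 <= j' < j)%N -> rmem s' (Rmx, i, j') = (i == j')%:R
    & same_outside (fun a => a.1.1 == Rmx) s s']) 1 k.+1.
rewrite (maxn_idPr _) // => h; apply: (wp_mono (h _ _ _ _)).
- by split => // j; lia.
- move=> j s2 hj [g1 g2 g3]; rewrite /wp /=; split.
  + move=> i' j' hi' hj'; rewrite /= !xpair_eqE /= ifF ?g1 //; lia.
  + move=> j' hj'; rewrite /= !xpair_eqE !eqxx /=; case: eqP => [->|ne]; first by [].
    by rewrite g2 //; lia.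
  + split; last by case: g3.
    move=> [[ar i'] j'] /= ha; rewrite !xpair_eqE (negPf ha) /=.
    by case: g3 => ->.
- move=> _ s2 [g1 g2 g3]; split => // i' j hi' hj.
  by case: (ltngtP i' i) => [lt|gt|->]; [apply: g1|lia|apply: g2]; lia.
Qed.

(** Column c is touched in round c only, so the result of the whole loop is expressed by the memory
    before it. *)
Lemma wp_eliminate (t : R) (r p : nat) (s : state R) : (p <= r.+1)%N ->
  wp (eliminate t r p) (fun _ s' =>
    (forall a, rmem s' a =
      if (a.1 == (Rmx, p)) && (p <= a.2 <= r.+1)%N then
        cos t * rmem s (Rmx, p, a.2) + sin t * rmem s (Row, 0%N, a.2)
      else if (a.1 == (Row, 0%N)) && (p <= a.2 <= r.+1)%N then
        cos t * rmem s (Row, 0%N, a.2) - sin t * rmem s (Rmx, p, a.2)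
      else rmem s a) /\ nmem s' = nmem s) s.
Proof.
move=> pr; rewrite /eliminate /from_to addn1.
have := @wp_for_each R (fun c s' =>
    (forall a, rmem s' a =
      if (a.1 == (Rmx, p)) && (p <= a.2 < c)%N then
        cos t * rmem s (Rmx, p, a.2) + sin t * rmem s (Row, 0%N, a.2)
      else if (a.1 == (Row, 0%N)) && (p <= a.2 < c)%N then
        cos t * rmem s (Row, 0%N, a.2) - sin t * rmem s (Rmx, p, a.2)
      else rmem s a) /\ nmem s' = nmem s) p r.+2.
rewrite (maxn_idPr _) 1?leqW // => h; apply: h.
  by split => // a; rewrite !ifF //; lia.
move=> c s1 hc [h1 h2]; apply: (wp_mono (wp_rotate _ _ _)).
  by rewrite !xpair_eqE.
move=> _ s2 [g1 g2 g3 g4]; rewrite /= in g1 g2 g3 g4; split; last by rewrite g4.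
have mR : rmem s1 (Rmx, p, c) = rmem s (Rmx, p, c).
  by rewrite h1 /= !xpair_eqE /= ltnn !andbF.
have mr : rmem s1 (Row, 0%N, c) = rmem s (Row, 0%N, c).
  by rewrite h1 /= ltnn !andbF.
move=> [[ar i] j].
case: (eqVneq ((ar, i, j) : addr) (Rmx, p, c)) => [[-> -> ->]|n1].
  by rewrite g1 mR mr /= eqxx /= ifT //; lia.
case: (eqVneq ((ar, i, j) : addr) (Row, 0%N, c)) => [[-> -> ->]|n2].
  by rewrite g2 mR mr /= ifT //; lia.
rewrite g3 // h1 /=.
have e : ((ar, i) == (Rmx, p)) && (p <= j < c.+1)%N = ((ar, i) == (Rmx, p)) && (p <= j < c)%N.
  move: n1; rewrite !xpair_eqE; case: (ar == Rmx); case: (i == p) => //=; lia.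
have e' : ((ar, i) == (Row, 0%N)) && (p <= j < c.+1)%N = ((ar, i) == (Row, 0%N)) && (p <= j < c)%N.
  move: n2; rewrite !xpair_eqE; case: (ar == Row); case: (i == 0%N) => //=; lia.
by rewrite e e'.
Qed.

Lemma wp_extend_R (r : nat) (s : state R) : (k <= r)%N ->
  wp (extend_R k bk r) (fun _ s' =>
    [/\ forall i, (r - k < i <= r)%N -> rmem s' (Rmx, i, r.+1) = 0,
        rmem s' (Rmx, r.+1, r.+1) = 1,
        forall c, (r - k < c <= r.+1)%N -> rmem s' (Row, 0%N, c) = diff_row k bk r c,
        forall i c, (c <= r)%N -> rmem s' (Rmx, i, c) = rmem s (Rmx, i, c) &
        same_outside (fun a => a.1.1 \in [:: Rmx; Row]) s s']) s.
Proof.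
move=> kr; rewrite /extend_R.
apply: wp_op; apply: wp_op; apply: wp_bind.
have := @wp_for_each R (fun i s' =>
    [/\ forall i', (r - k < i' < i)%N -> rmem s' (Rmx, i', r.+1) = 0,
      forall i c, (c <= r)%N -> rmem s' (Rmx, i, c) = rmem s (Rmx, i, c) &
        same_outside (fun a => a.1.1 \in [:: Rmx; Row]) s s']) (r - k).+1 r.+1.
rewrite /from_to !addn1 (maxn_idPr _); last by lia.
move=> h; apply: (wp_mono (h _ _ _ _)) => {h}.
- by split => // i; lia.
- move=> i s1 hi [h1 h2 h3]; rewrite /wp /=; split.
  + move=> i' hi' /=; rewrite ?xpair_eqE /= eqxx andbT.
    by case: eqP => // ne; apply: h1; lia.
  + by move=> i' c hc /=; rewrite ?xpair_eqE /= ifF ?h2 //; lia.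
  + split; last by case: h3.
    move=> [[ar i'] j'] /= ha; rewrite ?xpair_eqE.
    by case: h3 => h3 _; rewrite ifF ?h3 //; move: ha; case: ar.
move=> _ s1 [h1 h2 h3].
apply: wp_write.
have := @wp_for_each R (fun j s' =>
    [/\ forall i, (r - k < i <= r)%N -> rmem s' (Rmx, i, r.+1) = 0,
        rmem s' (Rmx, r.+1, r.+1) = 1,
        forall c, (r - k < c <= r - k + j)%N -> rmem s' (Row, 0%N, c) = diff_row k bk r c,
        forall i c, (c <= r)%N -> rmem s' (Rmx, i, c) = rmem s (Rmx, i, c) &
        same_outside (fun a => a.1.1 \in [:: Rmx; Row]) s s']) 0%N k.+1.
rewrite (maxn_idPr _) //.
move=> h; apply: (wp_mono (h _ _ _ _)) => {h}.
- split.
  + by move=> i hi /=; rewrite ?xpair_eqE /= ifF ?h1 //; lia.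
  + by rewrite /= eqxx.
  + by move=> c; lia.
  + by move=> i c hc /=; rewrite ?xpair_eqE /= ifF ?h2 //; lia.
  + split; last by case: h3.
    move=> [[ar i'] j'] /= ha; rewrite ?xpair_eqE.
    by case: h3 => h3 _; rewrite ifF ?h3 //; move: ha; case: ar.
- move=> j s3 hj [g1 g2 g3 g4 g5]; rewrite /wp /=; split.
  + by move=> i hi; rewrite /= ?xpair_eqE /= g1.
  + by rewrite ?xpair_eqE /= g2.
  + move=> c hc; rewrite /= ?xpair_eqE /=; case: eqP => [->|ne]; last by apply: g3; lia.
    rewrite /diff_row ifT; last by lia.
    rewrite /diff_coef (_ : (_ - (r - k).+1 = j)%N); last by lia.
    by rewrite rmorphM rmorphXn /= rmorphN1 -pmulrn.
  + by move=> i c hc; rewrite /= ?xpair_eqE /= g4.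
  + split; last by case: g5.
    move=> [[ar i'] j'] /= ha; rewrite ?xpair_eqE.
    by case: g5 => g5 _; rewrite ifF ?g5 //; move: ha; case: ar.
move=> _ s3 [g1 g2 g3 g4 g5]; split => // c hc.
by apply: g3; lia.
Qed.

End Rotations.

(** * Stored angles, rotated data and the error update *)

Section Factorization.
Variables (R : realType) (k N : nat) (beta : R) (f : nat -> R).
Local Notation bk := (beta ^+ k).

Lemma tri_small (r : nat) : (r <= k)%N -> tri k bk r = (fun c i => (i == c)%:R).
Proof. by elim: r => //= r IH hr; rewrite hr IH // ltnW. Qed.

(* Only the band i <= c <= i + k is stored. *)
Definition stores_tri (r : nat) (s : state R) : Prop :=
  forall i c, (0 < i <= c)%N -> (c <= r)%N -> (c <= i + k)%N ->
  rmem s (Rmx, i, c) = tri k bk r c i.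

(** The entries of [Row] in columns already eliminated are not read again in this round and are left
    unspecified. *)
Definition stores_steps (r m : nat) (s : state R) : Prop :=
  (forall i c, (0 < i <= c)%N -> (c <= r.+1)%N -> (c <= i + k)%N ->
     rmem s (Rmx, i, c) = (tri_steps k bk r m (tri k bk r) c).1 i) /\
  (forall c, (r - k + m < c <= r.+1)%N ->
     rmem s (Row, 0%N, c) = (tri_steps k bk r m (tri k bk r) c).2).

Lemma stores_steps_tri (r : nat) (s : state R) : (k <= r)%N ->
  stores_steps r k.+1 s -> stores_tri r.+1 s.
Proof.
move=> kr [h _] i c hi hc hik; rewrite h //=.
by rewrite ltnNge kr.
Qed.

Lemma init_R_stores_tri (s : state R) :
  wp (init_R R k) (fun _ s' => stores_tri k s' /\
    same_outside (fun a => a.1.1 == Rmx) s s') s.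
Proof.
apply: (wp_mono (wp_init_R k s)) => _ s' [h1 h2]; split => //.
move=> i c hi hc _; rewrite tri_small // h1 //; lia.
Qed.

Lemma extend_R_stores_steps (r : nat) (s : state R) : (k <= r)%N -> stores_tri r s ->
  wp (extend_R k bk r) (fun _ s' => stores_steps r 0 s' /\
    same_outside (fun a => a.1.1 \in [:: Rmx; Row]) s s') s.
Proof.
move=> kr h; apply: (wp_mono (wp_extend_R beta s kr)) => _ s' [h1 h2 h3 h4 h5].
split=> //; split; last by move=> c hc; rewrite h3 //=; lia.
case: (tri_triangular k bk r) => _ _ _ T4.
move=> i c hi hc hik /=.
case: (leqP c r) => cr; first by rewrite h4 // h.
have -> : c = r.+1 by lia.
rewrite T4 //; case: eqP => [->|ne]; first exact: h2.
by rewrite h1 //; lia.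
Qed.

Lemma eliminate_stores_steps (r m : nat) (s : state R) : (k <= r)%N -> (m <= k)%N ->
  stores_steps r m s ->
  wp (eliminate (theta k bk r m.+1) r (r - k + m.+1)) (fun _ s' => stores_steps r m.+1 s' /\
    same_outside (fun a => a.1.1 \in [:: Rmx; Row]) s s') s.
Proof.
move=> kr mk [h1 h2]; apply: (wp_mono (wp_eliminate _ _ _)); first by lia.
set p := (r - k + m.+1)%N.
move=> _ s' [g1 g2]; split; last first.
  split=> // -[[ar i] j] ha; rewrite g1 /=.
  by rewrite !xpair_eqE /=; move: ha; case: ar.
split.
  move=> i c hi hc hik; rewrite g1 /= !xpair_eqE /=.
  case: eqP => [ip|ne] /=; last by rewrite h1.
  rewrite ip in hi hik *; rewrite ifT; last by lia.
  by rewrite h1 ?h2; [|lia..].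
move=> c hc; rewrite g1 /= ifT; last by lia.
by rewrite h1 ?h2; [|lia..].
Qed.

Lemma wp_angle (a b : R) (s : state R) :
  wp (angle a b) (fun t s' => t = givens_angle a b /\ same_outside xpred0 s s') s.
Proof. by []. Qed.

Definition stores_theta (r m : nat) (s : state R) : Prop :=
  rmem s (theta_addr k N r m) = theta k bk r m.

Lemma wp_precompute (s : state R) :
  wp (precompute k N bk) (fun _ s' =>
    (forall r m, (k <= r < N)%N -> (0 < m <= k.+1)%N -> stores_theta r m s') /\
    same_outside (fun a => a.1.1 \in [:: Rmx; Row; Theta]) s s') s.
Proof.
rewrite /precompute; apply: wp_bind.
apply: (wp_mono (init_R_stores_tri s)) => _ s1 [hR hs].
have := @wp_for_each R (fun r s' =>
   [/\ stores_tri r s',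
    forall r' m, (k <= r' < r)%N -> (0 < m <= k.+1)%N -> stores_theta r' m s' &
    same_outside (fun a => a.1.1 \in [:: Rmx; Row; Theta]) s s']) k N.
move=> h; apply: (wp_mono (h _ _ _ _)) => {h}.
- split=> //; first by move=> r' m; lia.
  by apply: same_outside_trans hs (_ : same_outside xpred0 s1 s1) => // -[[[] i] j].
- move=> r s2 hr [g1 g2 g3]; apply: wp_bind.
  have kr : (k <= r)%N by case/andP: hr.
  apply: (wp_mono (extend_R_stores_steps kr (s := step s2) g1)) => _ s3 [e1 e2].
  have := @wp_for_each R (fun m s' =>
   [/\ stores_steps r m.-1 s',
    forall r' m, (k <= r' < r)%N -> (0 < m <= k.+1)%N -> stores_theta r' m s',
    forall m', (0 < m' < m)%N -> stores_theta r m' s' &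
    same_outside (fun a => a.1.1 \in [:: Rmx; Row; Theta]) s s']) 1 k.+2.
  rewrite /from_to addn1 (maxn_idPr _) //.
  move=> h; apply: (wp_mono (h _ _ _ _)) => {h}.
  + split => //.
    * move=> r' m hr' hm; rewrite /stores_theta; case: e2 => -> // _; exact: g2.
    * by move=> m'; lia.
    * by apply: same_outside_trans g3 e2 => -[[[] i] j].
  + move=> m s4 hm [j1 j2 j3 j4].
    apply: wp_read; apply: wp_read; apply: wp_bind.
    apply: (wp_mono (wp_angle _ _ _)) => t s5 [tE [m5 n5]].
    have {}tE : t = theta k bk r m.
      rewrite tE /theta; case: j1 => j1 j1'.
      by congr (givens_angle _ _); [apply: j1'|apply: j1]; lia.
    apply: wp_write; rewrite tE.
    set s6 := step _.
    have [m' mE] : exists m', m = m'.+1 by exists m.-1; lia.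
    rewrite mE in hm j1 j2 j3 j4 s6 tE *.
    have d6 : same_outside (fun a => a == theta_addr k N r m'.+1) s4 s6.
      by split => [a /= /negPf ->|//]; rewrite ?m5.
    have st6 : stores_steps r m' s6.
      by case: j1 => j1 j1'; split => [i c hi hc hik|c hc]; rewrite d6.1 ?j1 ?j1'.
    have hm' : (m' <= k)%N by lia.
    apply: (wp_mono (eliminate_stores_steps kr hm' st6)) => _ s7 [q1 q2].
    have q3 : same_outside (fun a => (a.1.1 \in [:: Rmx; Row]) ||
        (a == theta_addr k N r m'.+1)) s4 s7.
      apply: same_outside_trans d6 q2 => a /= ->; rewrite ?orbT //.
    split=> //.
    (* No angle is overwritten: rounds differ in the row index N + r + 1 - k, the rotations of one
       round in the column index. *)
    * move=> r' m0 hr' hm0; rewrite /stores_theta q3.1 ?j2 //=.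
      by apply/negP; rewrite !xpair_eqE /=; lia.
    * move=> m0 hm0; rewrite /stores_theta.
      case: (eqVneq m0 m'.+1) => [->|ne].
        by rewrite q2.1 //= eqxx.
      rewrite q3.1 /=; first by rewrite j3 //; lia.
      by apply/negP; rewrite !xpair_eqE /=; lia.
    * by apply: same_outside_trans j4 q3 => -[[[] i] j] //=.
  + move=> _ s4 [j1 j2 j3 j4]; split=> //; first exact: stores_steps_tri.
    move=> r' m hr' hm; case: (eqVneq r' r) => [->|ne]; first exact: j3.
    by apply: j2 => //; lia.
move=> _ s2 [g1 g2 g3]; split=> // r m hr hm; apply: g2 => //; lia.
Qed.

(** What all phases after the precomputation rely on and none of them writes. *)
Definition ready (s : state R) : Prop :=
  (forall i, rmem s (Data, 0%N, i) = f i) /\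
  (forall r m, (k <= r < N)%N -> (0 < m <= k.+1)%N -> stores_theta r m s).

Lemma ready_same_outside (W : pred addr) (s s' : state R) :
  (forall a, a.1.1 \in [:: Data; Theta] -> ~~ W a) ->
  same_outside W s s' -> ready s -> ready s'.
Proof.
move=> hW [h _] [h1 h2]; split => [i|r m hr hm]; first by rewrite h ?hW.
by rewrite /stores_theta h ?hW // h2.
Qed.

(** Each left bound owns a row of [Qtop] and of [Qbot], so advancing one candidate leaves the others
    intact. *)
Definition in_q (l : nat) : pred addr :=
  fun a => (a.1.1 \in [:: Qtop; Qbot]) && (a.1.2 == l).

Definition stores_rhs (l n : nat) (s : state R) : Prop :=
  forall i, (0 < i <= n)%N -> rmem s (Qtop, l, i) = rhs k bk f l n i.

Lemma q_addr_top (l r i : nat) : (i <= r)%N -> q_addr l r i = (Qtop, l, i).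
Proof. by rewrite /q_addr => ->. Qed.

Lemma q_addr_bot (l r : nat) : (k <= r)%N ->
  q_addr l r.+1 (2 * r.+1 - k) = (Qbot, l, r.+1 - k)%N.
Proof. by move=> kr; rewrite /q_addr ifF; [congr (_, _)|]; lia. Qed.

Lemma wp_init_q (l : nat) (s : state R) : ready s ->
  wp (init_q R k l) (fun _ s' => stores_rhs l k s' /\ same_outside (in_q l) s s') s.
Proof.
move=> [hd _].
have := @wp_for_each R (fun i s' =>
   (forall i', (0 < i' < i)%N -> rmem s' (Qtop, l, i') = f (l + i' - 1)%N)
    /\ same_outside (in_q l) s s') 1 k.+1.
rewrite (maxn_idPr _) // => h; apply: (wp_mono (h _ _ _ _)) => {h}.
- by split => // i; lia.
- move=> i s1 hi [h1 h2].
  apply: wp_read; rewrite q_addr_top; last by lia.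
  rewrite /wp /=; split.
    move=> i' hi' /=; rewrite xpair_eqE eqxx /=.
    case: eqP => [->|ne]; last by rewrite h1 //; lia.
    by rewrite h2.1.
  split; last by case: h2.
  move=> [[ar l'] j] /= ha; rewrite !xpair_eqE -h2.1 //.
  by case: ifP => // hh; move: ha; rewrite /in_q /=; case: ar hh => //=; case: eqP.
move=> _ s1 [h1 h2]; split => // i hi.
by rewrite h1 // /rhs top_small.
Qed.

Lemma wp_update_q (l r : nat) (s : state R) : ready s -> (k <= r < N)%N ->
  stores_rhs l r s ->
  wp (update_q R k N l r) (fun _ s' =>
    [/\ stores_rhs l r.+1 s', rmem s' (Qbot, l, r.+1 - k)%N = resid k bk f l r &
        same_outside (in_q l) s s']) s.
Proof.
move=> hrd hr hq; have kr : (k <= r)%N by case/andP: hr.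
rewrite /update_q !addn1; apply: wp_read; rewrite q_addr_top //.
apply: wp_write; apply: wp_op; rewrite q_addr_bot //; apply: wp_write.
set s1 := step _.
have inb : in_q l (Qbot, l, r.+1 - k)%N by rewrite /in_q /= eqxx.
have int i : in_q l (Qtop, l, i)%N by rewrite /in_q /= eqxx.
have s01 : same_outside (in_q l) s s1.
  split=> // -[[ar l'] j] ha /=.
  by rewrite ifF ?ifF //; apply/negP => /eqP e; rewrite e ?inb ?int in ha.
have := @wp_for_each R (fun m s' =>
   let st := rotations (theta k bk r) (r - k) m.-1 (rhs k bk f l r, 0) in
   [/\ forall i, (0 < i <= r.+1)%N -> rmem s' (Qtop, l, i) = st.1 i,
       rmem s' (Qbot, l, r.+1 - k)%N = st.2 & same_outside (in_q l) s s']) 1 k.+2.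
rewrite (maxn_idPr _) // => h; apply: (wp_mono (h _ _ _ _)) => {h}.
- split => // [i hi /=|/=]; last by rewrite eqxx.
  rewrite !xpair_eqE !eqxx /=.
  case: eqP => [->|ne]; last by rewrite hq //; lia.
  by rewrite hrd.1 /rhs top_out // addnS subn1.
- move=> m s2 hm [h1 h2 h3].
  have [m' mE] : exists m', m = m'.+1 by exists m.-1; lia.
  subst m; rewrite /= in h1 h2.
  apply: wp_read; rewrite q_addr_top; last by lia.
  have rd2 : ready s2.
    apply: ready_same_outside h3 hrd => -[[ar i] j].
    by rewrite /in_q /=; case: ar.
  rewrite -[rmem _ _]/(rmem s2 (theta_addr k N r m'.+1)).
  have -> : rmem s2 (theta_addr k N r m'.+1) = theta k bk r m'.+1.
    by apply: rd2.2 => //; lia.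
  apply: (wp_mono (wp_rotate _ _ _)); first by rewrite !xpair_eqE.
  move=> _ s3 [g1 g2 g3 g4]; rewrite /= in g1 g2 g3 g4; split => /=.
  + move=> i hi; rewrite -h2 -!h1 //; last by lia.
    case: eqP => [->|/eqP ne]; first by rewrite g1.
    by rewrite g3 // !xpair_eqE !eqxx.
  + by rewrite g2 h2 h1 //; lia.
  + split; last by rewrite g4; case: h3.
    move=> a ha; rewrite g3 ?h3.1 //; apply/eqP => e; by rewrite e ?inb ?int in ha.
move=> _ s2 [h1 h2 h3]; split => // i hi.
by rewrite h1 // /rhs topS.
Qed.

(* Up to length k there is nothing to store, the right-hand side being the data. *)
Definition carries (l n : nat) (s : state R) : Prop := (k < n)%N -> stores_rhs l n s.

Lemma wp_update_error (l t : nat) (e : R) (s : state R) :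
  ready s -> (0 < l <= t)%N -> (t < N)%N ->
  e = itv_error k bk f l (t.+1 - l) -> carries l (t.+1 - l) s ->
  wp (update_error k N l t e) (fun e' s' =>
    [/\ e' = itv_error k bk f l (t.+2 - l), carries l (t.+2 - l) s' &
        same_outside (in_q l) s s']) s.
Proof.
move=> hrd hl ht he hc; rewrite /update_error addn1.
have [r rE] : exists r, r = (t.+1 - l)%N by eexists.
have -> : (t.+2 - l = r.+1)%N by lia.
rewrite -rE in he hc *.
case: ltnP => hr; first by rewrite /wp /= itv_error_small //; split => // ?; lia.
apply: wp_bind.
(* At length exactly k the vector is loaded from the data, since [carries] promises nothing
   there. *)
apply: (@wp_mono _ _ _ (fun _ s1 => stores_rhs l r s1 /\ same_outside (in_q l) s s1)).
  case: eqP => [rk|ne]; last by apply: wp_ret; split => //; apply: hc; lia.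
  by rewrite {1}rk; apply: wp_init_q.
move=> _ s1 [h1 h2]; apply: wp_bind.
have rd1 : ready s1.
  apply: ready_same_outside h2 hrd => -[[ar i] j].
  by rewrite /in_q /=; case: ar.
apply: (wp_mono (wp_update_q rd1 _ h1)); first by lia.
move=> _ s2 [g1 g2 g3].
rewrite addn1 q_addr_bot //; apply: wp_read; apply: wp_op.
rewrite g2 /wp /=; split => //.
  by rewrite he /itv_error big_nat_recr //= expr2.
by apply: same_outside_trans h2 g3.
Qed.

End Factorization.

(** * Back substitution on one interval *)

Section Solve.
Variables (R : realType) (k N : nat) (beta : R) (f : nat -> R).
Local Notation bk := (beta ^+ k).

Lemma wp_for_each_rev (I : nat -> state R -> Prop) (a b : nat)
    (body : nat -> prog R unit) (s : state R) : (a <= b)%N ->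
  I b s ->
  (forall i s, (a <= i < b)%N -> I i.+1 s -> wp (body i) (fun=> I i) (step s)) ->
  wp (for_each (rev (index_iota a b)) body) (fun=> I a) s.
Proof.
move=> ab; elim: b ab s => [|b IH] ab s h0 hI.
  by move: h0; rewrite (_ : a = 0%N) //; lia.
case: (ltngtP a b.+1) ab => // [ab _|-> _]; last first.
  by rewrite /index_iota subnn; exact: h0.
have -> : rev (index_iota a b.+1) = b :: rev (index_iota a b).
  by rewrite /index_iota subSn // -addn1 iotaD rev_cat subnKC.
change (wp (bind (body b) (fold (rev (index_iota a b)) (fun=> body)))
  (fun=> I a) (step s)).
apply: wp_bind; apply: (wp_mono (hI b s _ h0)); first by lia.
by case=> s' h; apply: IH => // i s'' hi; apply: hI; lia.
Qed.

Lemma stores_tri_step (m : nat) (s : state R) : ready k N beta f s -> (k <= m < N)%N ->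
  stores_tri k beta m s ->
  wp (extend_R k bk m;; for_each (from_to 1 (k + 1)) (fun j =>
        let! theta := read R (theta_addr k N m j) in
        eliminate theta m (m - k + j)))
    (fun _ s' => stores_tri k beta m.+1 s' /\
       same_outside (fun a => a.1.1 \in [:: Rmx; Row]) s s') s.
Proof.
move=> hrd hm hR; have km : (k <= m)%N by case/andP: hm.
apply: wp_bind; apply: (wp_mono (extend_R_stores_steps km hR)) => _ s1 [h1 h2].
have := @wp_for_each R (fun j s' => stores_steps k beta m j.-1 s' /\
  same_outside (fun a => a.1.1 \in [:: Rmx; Row]) s s') 1 k.+2.
rewrite /from_to addn1 (maxn_idPr _) // => h; apply: (wp_mono (h _ _ _ _)) => {h} //.
- move=> j s2 hj [g1 g2].
  have [j' jE] : exists j', j = j'.+1 by exists j.-1; lia.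
  subst j; apply: wp_read.
  rewrite -[rmem _ _]/(rmem s2 (theta_addr k N m j'.+1)).
  have -> : rmem s2 (theta_addr k N m j'.+1) = theta k bk m j'.+1.
    by rewrite g2.1 //; apply: hrd.2 => //; lia.
  have hj' : (j' <= k)%N by lia.
  apply: (wp_mono (eliminate_stores_steps (s := step (step s2)) km hj' g1)).
  move=> _ s3 [e1 e2]; split => //.
  by apply: same_outside_trans g2 e2.
- by move=> _ s2 [g1 g2]; split => //; apply: stores_steps_tri.
Qed.

Definition in_solve (l r : nat) : pred addr := fun a =>
  (a.1.1 \in [:: Rmx; Row; Qtop; Qbot]) || ((a.1 == (Sol, 0%N)) && (l <= a.2 <= r)%N).

Definition sol (s : state R) (i : nat) : R := rmem s (Sol, 0%N, i).

Lemma wp_solve (l r : nat) (s : state R) : ready k N beta f s ->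
  (0 < l <= r)%N -> (r <= N)%N ->
  wp (solve k N bk l r) (fun _ s' =>
    itv_cost k bk f l (r.+1 - l) (sol s') = itv_error k bk f l (r.+1 - l) /\
    same_outside (in_solve l r) s s') s.
Proof.
move=> hrd hl hr; rewrite /solve addn1.
have [n nE] : exists n, n = (r.+1 - l)%N by eexists.
rewrite -nE; case: (leqP n k) => hn.
  have := @wp_for_each R (fun i s' =>
    (forall j, (l <= j < i)%N -> sol s' j = f j) /\ same_outside (in_solve l r) s s') l r.+1.
  rewrite (maxn_idPr _); last by lia.
  move=> h; apply: (wp_mono (h _ _ _ _)) => {h}.
  - by split => // j; lia.
  - move=> i s1 hi [h1 h2]; apply: wp_read; rewrite /wp /= /sol; split => /=.
      move=> j hj; rewrite xpair_eqE eqxx /=; case: eqP => [->|ne].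
        by rewrite h2.1 // hrd.1.
      by rewrite -[rmem _ _]/(sol s1 j) h1 //; lia.
    split; last by case: h2.
    move=> [[ar l'] j] /= ha; rewrite ifF ?h2.1 //.
    by apply/eqP => -[e1 e2 e3]; move: ha; rewrite /in_solve e1 e2 e3 /=; lia.
  - move=> _ s1 [h1 h2]; split => //.
    rewrite itv_error_small // /itv_cost [X in _ + X]big_geq; last by lia.
    rewrite addr0 big_nat big1 // => i hi.
    by rewrite h1 ?subrr ?expr0n //; lia.
apply: wp_bind; apply: (wp_mono (init_R_stores_tri k beta s)) => _ s1 [a1 a2].
apply: wp_bind.
have rd1 : ready k N beta f s1.
  by apply: ready_same_outside a2 hrd => -[[ar i] j] /=; case: ar.
apply: (wp_mono (wp_init_q l rd1)) => _ s2 [b1 b2].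
have c2 : same_outside (in_solve l r) s s2.
  apply: same_outside_trans a2 b2 => -[[ar i] j] /=; rewrite /in_solve /in_q /=.
    by move=> /eqP ->.
  by case: ar.
apply: wp_bind.
have := @wp_for_each R (fun m s' =>
   [/\ stores_tri k beta m s', stores_rhs k beta f l m s' & same_outside (in_solve l r) s s']) k n.
rewrite (maxn_idPr _); last exact: ltnW.
have rdW s' : same_outside (in_solve l r) s s' -> ready k N beta f s'.
  move=> h; apply: ready_same_outside h hrd => -[[ar i] j] /=.
  by rewrite /in_solve /=; case: ar.
move=> h; apply: (wp_mono (h _ _ _ _)) => {h}.
- split => //.
  move=> i c hi hc hik; rewrite b2.1; first exact: a1.
  by [].
- move=> m s3 hm [h1 h2 h3]; apply: wp_bind.
  have hmN : (k <= m < N)%N by lia.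
  apply: (wp_mono (wp_update_q (s := step s3) (rdW _ h3) hmN h2)) => _ s4 [g1 g2 g3].
  have h4 : same_outside (in_solve l r) s s4.
    apply: same_outside_trans h3 g3 => -[[ar i] j] //=.
    by rewrite /in_solve /in_q /=; case: ar.
  have tr4 : stores_tri k beta m s4.
    by move=> i c hi hc hik; rewrite g3.1 //=; apply: h1.
  apply: (wp_mono (stores_tri_step (rdW _ h4) hmN tr4)) => _ s5 [e1 e2]; split => //.
  + by move=> i hi; rewrite e2.1 // g1.
  + apply: same_outside_trans h4 e2 => -[[ar i] j] //=.
    by rewrite /in_solve /=; case: ar.
move=> _ s3 [h1 h2 h3].
have := @wp_for_each_rev (fun i s' =>
  [/\ forall i', (i <= i' <= n)%N -> solves k bk f l n i' (sol s'),
    stores_tri k beta n s', stores_rhs k beta f l n s' & same_outside (in_solve l r) s s'])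
  1 n.+1.
move=> h; apply: (wp_mono (h _ _ _ _ _)) => {h} //.
- by split => // i'; lia.
- move=> i s4 hi [g1 g2 g3 g4].
  apply: wp_read; rewrite q_addr_top; last by lia.
  rewrite [rmem _ _]g3; last by lia.
  apply: wp_bind.
  have := @wp_fold R R (fun j z s' => z = rhs k bk f l n i -
      \sum_(i.+1 <= c < j) tri k bk n c i * sol s4 (l + c - 1)%N
     /\ same_outside xpred0 s4 s') i.+1 (minn (i + k) n).+1.
  rewrite /from_to addn1 (maxn_idPr _); last by lia.
  move=> h; apply: (wp_mono (h _ _ _ _ _)) => {h}.
  + by rewrite big_geq // subr0.
  + move=> j z s5 hj [-> h5].
    apply: wp_read; apply: wp_read; apply: wp_op; rewrite /wp /=; split => //.
    rewrite big_nat_recr /=; last by lia.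
    rewrite opprD addrA; congr (_ - _ * _); first by rewrite h5.1 // g2 //; lia.
    by rewrite h5.1.
  move=> z s5 [zE h5]; apply: wp_read; apply: wp_op; rewrite /wp /=.
  set s6 := step _.
  have dE : rmem s5 (Rmx, i, i) = tri k bk n i i.
    by rewrite h5.1 // g2 //; lia.
  have d0 : tri k bk n i i != 0.
    by case: (tri_triangular k bk n) => _ T2 _ _; rewrite gt_eqF.
  have s6E j : sol s6 j = if j == (l + i - 1)%N then z / tri k bk n i i else sol s4 j.
    by rewrite /sol /= xpair_eqE eqxx /= dE h5.1.
  have d6 a : a.1.1 != Sol -> rmem s6 a = rmem s4 a.
    case: a => -[ar i'] j' /= /negPf ne.
    by rewrite !xpair_eqE ne /= h5.1.
  (* The new value sits at l + i - 1, while these sums involve only unknowns with larger index;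
     equations solved before remain valid. *)
  have eqs i' : (i <= i')%N -> (1 <= i' <= n)%N ->
      \sum_(i'.+1 <= c < (minn (i' + k) n).+1) tri k bk n c i' * sol s6 (l + c - 1)%N =
      \sum_(i'.+1 <= c < (minn (i' + k) n).+1) tri k bk n c i' * sol s4 (l + c - 1)%N.
    move=> hi' hi''; apply: eq_big_nat => c hc; rewrite s6E ifF //; apply/eqP; lia.
  split.
  + move=> i' hi'; rewrite /solves tri_row_sum ?eqs //; [|lia..].
    case: (ltngtP i i') hi' => // [lt hi'|<- hi'].
      rewrite s6E ifF; last by apply/eqP; lia.
      rewrite -(tri_row_sum k bk (n := n) (i := i') (fun c => sol s4 (l + c - 1)%N)); last by lia.
      by apply: g1; lia.
    by rewrite s6E eqxx zE mulrC divfK // subrK.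
  + by move=> i' c hi' hc hik; rewrite d6 // g2.
  + by move=> i' hi'; rewrite d6 // g3.
  + split; last by rewrite /= h5.2 g4.2.
    move=> [[ar i'] j'] ha; rewrite -g4.1 //= ifF ?h5.1 //.
    apply/eqP => -[e1 e2 e3]; move: ha; rewrite /in_solve e1 e2 e3 /=; lia.
move=> _ s4 [g1 g2 g3 g4]; split => //.
by apply: itv_cost_solves => i hi; apply: g1.
Qed.

End Solve.

(** * Candidates and pruning *)

Section Pruning.
Variables (R : realType) (k N : nat) (beta gamma : R) (f : nat -> R).
Local Notation bk := (beta ^+ k).
Local Notation E l r := (itv_error k bk f l (r.+1 - l)).
Local Notation ready := (ready k N beta f).
Local Notation carries := (carries k beta f).

Lemma itv_error_split (l t r : nat) : (0 < l <= t)%N -> (t < r)%N ->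
  E l t + E t.+1 r <= E l r.
Proof.
move=> lt tr; have := itv_error_superadditive k bk f (t.+1 - l) (r.+1 - t.+1) (l := l).
rewrite (_ : (l + (t.+1 - l) = t.+1)%N); last by lia.
by rewrite (_ : (t.+1 - l + (r.+1 - t.+1) = r.+1 - l)%N); [apply; lia|lia].
Qed.

Lemma wp_first_errors (s : state R) : (0 < k)%N -> (0 < N)%N -> ready s ->
  wp (first_errors R k N) (fun _ s' =>
    [/\ ready s', forall r, (0 < r <= N)%N -> rmem s' (Err1, 0%N, r) = E 1%N r &
        same_outside (fun a => a.1.1 \in [:: Err1; Qtop; Qbot]) s s']) s.
Proof.
move=> k0 N0 hrd; rewrite /first_errors; apply: wp_op; apply: wp_write.
have rdW s' : same_outside (fun a => a.1.1 \in [:: Err1; Qtop; Qbot]) s s' -> ready s'.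
  by move=> h; apply: ready_same_outside h hrd => -[[[] i] j].
have := @wp_for_each R (fun r s' =>
  [/\ forall r', (0 < r' < r)%N -> rmem s' (Err1, 0%N, r') = E 1%N r',
      carries 1 r.-1 s' &
      same_outside (fun a => a.1.1 \in [:: Err1; Qtop; Qbot]) s s']) 2 N.+1.
rewrite /from_to (maxn_idPr _) // => h; apply: (wp_mono (h _ _ _ _)) => {h}.
- split=> [r' hr'||].
  + have -> : r' = 1%N by lia.
    by rewrite /= itv_error_small.
  + by rewrite /=; move=> ?; lia.
  + by split => // -[[[] i] j].
- move=> r s1 hr [h1 h2 h3].
  apply: wp_read; apply: wp_bind.
  have eE : rmem s1 (Err1, 0%N, r - 1)%N = E 1%N (r - 1)%N by rewrite h1 //; lia.
  have hc : carries 1 ((r - 1).+1 - 1)%N (step s1).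
    by rewrite (_ : (_.+1 - 1 = r.-1)%N) //; lia.
  apply: (wp_mono (wp_update_error (s := step (step s1)) _ _ _ eE hc)); [|lia|lia|].
    exact: rdW h3.
  move=> e s2 [g1 g2 g3]; rewrite /wp /=.
  have rE : ((r - 1).+1 = r)%N by lia.
  rewrite rE in g1 g2; rewrite subn1 /= in g2.
  split.
  + move=> r' hr' /=; rewrite xpair_eqE eqxx /=; case: eqP => [->//|ne].
    by rewrite g3.1 // h1 //; lia.
  + by move=> hk i hi; rewrite /= g2.
  + split=> [a ha|]; last by rewrite /= g3.2 h3.2.
    rewrite /= ifF; last by apply/eqP => e'; rewrite e' in ha.
    rewrite g3.1 ?h3.1 //; case: a ha => -[ar i] j /=.
    by rewrite /in_q /=; case: ar.
- move=> _ s1 [h1 h2 h3]; split => //; exact: rdW.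
Qed.

Definition valid (r : nat) (c : candidate R) (s : state R) : Prop :=
  [/\ (1 < lb c <= rb c)%N, (rb c <= r)%N, err c = E (lb c) (rb c) &
      carries (lb c) ((rb c).+1 - lb c) s].

(** Only the row of the candidate is written, so all pruning tests refer to the values of P* in the
    initial state. *)
Lemma wp_advance (n : nat) (c : candidate R) (s : state R) :
  let Pv i := rmem s (Pstar, 0%N, i) in
  ready s -> valid (rb c) c s -> (rb c + n <= N)%N ->
  wp (advance k N n c) (fun oc s' => same_outside (in_q (lb c)) s s' /\
    if oc is Some c' then
      [/\ lb c' = lb c, rb c' = (rb c + n)%N & valid (rb c + n) c' s']
    else exists2 t, (rb c < t <= rb c + n)%N & Pv t <= Pv (lb c).-1 + E (lb c) t) s.
Proof.
elim: n c s => [|n IH] c s Pv hrd hv hn.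
  by rewrite /wp /=; split => //; rewrite addn0.
rewrite /advance -/advance; apply: wp_tick; cbv zeta; apply: wp_bind.
case: hv => [v1 v2 v3 v4].
apply: (wp_mono (wp_update_error (s := step s) hrd _ _ v3 v4)); [lia..|].
move=> _ s1 [-> g2 g3].
apply: wp_read; apply: wp_op; apply: wp_read; apply: wp_leq.
pose s2 := step (step (step (step s1))).
have pE i : rmem s1 (Pstar, 0%N, i) = Pv i by rewrite g3.1.
rewrite addn1 subn1; case: ifP => hp.
  rewrite /= !pE in hp.
  rewrite /wp /=; split; first by split; case: g3.
  by exists (rb c).+1; [lia|].
have v2' : valid (rb c).+1 (Candidate (lb c) (rb c).+1 (E (lb c) (rb c).+1)) s2.
  by split => //=; lia.
have rd2 : ready s2.
  apply: ready_same_outside g3 hrd => -[[ar i] j].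
  by rewrite /in_q /=; case: ar.
have IH' := IH (Candidate (lb c) (rb c).+1 (E (lb c) (rb c).+1)) s2 rd2 v2'.
apply: (@wp_mono _ _ (advance k N n _) _ _ s2 (IH' _)); first by rewrite /=; lia.
move=> oc s3 /= [q1 q2]; split; first exact: same_outside_trans g3 q1.
case: oc q2 => [c' [q2 q3 q4]|[t ht q]].
  by rewrite addnS -addSn.
exists t; first by lia.
by rewrite -!pE.
Qed.

Fixpoint all_valid (r : nat) (L : seq (candidate R)) (s : state R) : Prop :=
  if L is c :: L' then valid r c s /\ all_valid r L' s else True.

Local Notation lbs L := [seq lb c | c <- L].

Lemma all_valid_frame (W : pred addr) (r r' : nat) (L : seq (candidate R)) (s s' : state R) :
  (r <= r')%N -> (forall l i, l \in lbs L -> ~~ W (Qtop, l, i)) ->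
  (forall a, ~~ W a -> rmem s' a = rmem s a) -> all_valid r L s -> all_valid r' L s'.
Proof.
move=> rr; elim: L => //= c L IH hW h [[h1 h2 h3 h4] hv]; split.
  split => //; first exact: leq_trans rr.
  by move=> hk i hi; rewrite h ?h4 // hW ?mem_head.
by apply: IH => // l i hl; apply: hW; rewrite inE hl orbT.
Qed.

Lemma all_valid_lb (r l : nat) (L : seq (candidate R)) (s : state R) :
  all_valid r L s -> l \in lbs L -> (1 < l <= r)%N.
Proof.
elim: L => //= c L IH [[h1 h2 _ _] hv]; rewrite inE => /orP[/eqP ->|]; last exact: IH.
by lia.
Qed.

Definition scan_frame (r : nat) (ls : seq nat) (s s' : state R) : Prop :=
  (forall a, ~~ ((a.1.1 \in [:: Qtop; Qbot]) && (a.1.2 \in ls)) ->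
     a != (Pstar, 0%N, r) -> rmem s' a = rmem s a) /\
  (forall j, j != r -> nmem s' j = nmem s j).

Lemma scan_frame_trans (r : nat) (ls ls' ls'' : seq nat) (s s' s'' : state R) :
  {subset ls <= ls''} -> {subset ls' <= ls''} ->
  scan_frame r ls s s' -> scan_frame r ls' s' s'' -> scan_frame r ls'' s s''.
Proof.
move=> h h' [m n] [m' n']; split=> [a ha ha'|j hj]; last by rewrite n' ?n.
rewrite m' ?m //; apply: contra ha => /andP[-> /=]; [exact: h|exact: h'].
Qed.

Lemma scan_frame_ready (r : nat) (ls : seq nat) (s s' : state R) :
  scan_frame r ls s s' -> ready s -> ready s'.
Proof.
move=> [h _].
(* A scan may change J at r, which [same_outside] forbids. As [ready] does not look at J, the old J
   is put back into an auxiliary state. *)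
apply: (@ready_same_outside _ _ _ _ _ (fun a => ((a.1.1 \in [:: Qtop; Qbot]) && (a.1.2 \in ls))
  || (a == (Pstar, 0%N, r))) s (State (rmem s') (nmem s) 0%N)) => [[[ar i] j]|].
  by case: ar.
by split=> // a; rewrite negb_or => /andP[]; exact: h.
Qed.

Section Scan.
Variables (r : nat) (Pv : nat -> R).

Definition value (l : nat) : R := Pv l.-1 + gamma + E l r.

(** Values at t < r are settled, but P*_r may still decrease during the scan. The test at t = r
    therefore refers to the current memory, and a decrease preserves it. *)
Definition pruned (l : nat) (s : state R) : Prop :=
  (exists2 t, (l <= t < r)%N & Pv t <= Pv l.-1 + E l t) \/
  rmem s (Pstar, 0%N, r) <= Pv l.-1 + E l r.

Definition covers (s : state R) : Prop :=
  forall i, (0 < i < r)%N -> rmem s (Pstar, 0%N, i) = Pv i.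

(** [scanned_value] covers every left bound of L, including those that an early stop never
    reaches. *)
Record scanned (L L' : seq (candidate R)) (s s' : state R) : Prop := Scanned {
  scanned_frame : scan_frame r (lbs L) s s';
  scanned_le : rmem s' (Pstar, 0%N, r) <= rmem s (Pstar, 0%N, r);
  scanned_origin :
    (rmem s' (Pstar, 0%N, r) = rmem s (Pstar, 0%N, r) /\ nmem s' r = nmem s r) \/
    (exists2 l, l \in lbs L & nmem s' r = l.-1 /\ rmem s' (Pstar, 0%N, r) = value l);
  scanned_subseq : subseq (lbs L') (lbs L);
  scanned_valid : all_valid r L' s';
  scanned_value : forall l, l \in lbs L ->
    rmem s' (Pstar, 0%N, r) <= value l \/ pruned l s';
  scanned_pruned : forall l, l \in lbs L -> l \notin lbs L' -> pruned l s' }.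

Lemma pruned_le (l : nat) (s s' : state R) :
  rmem s' (Pstar, 0%N, r) <= rmem s (Pstar, 0%N, r) -> pruned l s -> pruned l s'.
Proof. by move=> h [|h']; [left|right; apply: le_trans h']. Qed.

Lemma wp_scan (L : seq (candidate R)) (s : state R) :
  (r <= N)%N -> (forall i, (0 < i < r)%N -> 0 <= Pv i) -> covers s -> ready s ->
  pairwise gtn (lbs L) -> all_valid r L s ->
  wp (scan gamma k N r L) (fun L' s' => scanned L L' s s') s.
Proof.
move=> rN Pv0; elim: L s => [|c L IH] s hP hrd hpw hv.
  by rewrite /wp /=; split => //; left.
have {hpw} /andP[hall hpw] : all (gtn (lb c)) (lbs L) && pairwise gtn (lbs L) := hpw.
case: hv => hc hv.
have [c1 c2 c3 c4] := hc.
rewrite /scan -/scan; apply: wp_tick; apply: wp_bind.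
have hcv : valid (rb c) c (step s) by split.
apply: (wp_mono (wp_advance (n := (r - rb c)%N) (s := step s) hrd hcv _)).
  by rewrite subnKC.
rewrite subnKC // => oc s1 [d1 d2].
have notin l : l \in lbs L -> (l < lb c)%N by move=> hl; apply: (allP hall).
have f1 : scan_frame r [:: lb c] s s1.
  split=> [a ha _|j _]; last by case: d1 => _ ->.
  rewrite d1.1 //; apply: contra ha => /andP[-> /eqP ->].
  exact: mem_head.
have rd1 := scan_frame_ready f1 hrd.
have PE i : rmem s1 (Pstar, 0%N, i) = rmem s (Pstar, 0%N, i) by rewrite d1.1.
have cv1 : covers s1 by move=> i hi; rewrite PE hP.
(* The left bounds are strictly descending, so work in the row of c does not disturb the remaining
   candidates. *)
have tailv s' ls : scan_frame r (lb c :: ls) s s' -> (forall l, l \in ls -> l \notin lbs L) ->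
    all_valid r L s'.
  move=> hf hls; apply: (all_valid_frame (W := fun a => ((a.1.1 \in [:: Qtop; Qbot]) &&
     (a.1.2 \in lb c :: ls)) || (a == (Pstar, 0%N, r))) (leqnn r) _ _ hv).
    move=> l i hl /=; rewrite orbF inE negb_or.
    have := notin _ hl; rewrite ltn_neqAle => /andP[-> _] /=.
    by apply/negP => /hls; rewrite hl.
  by move=> a; rewrite negb_or => /andP[]; apply: hf.1.
case: oc d2 => [c' [e1 e2 hv']|[t ht hpt]]; last first.
  have pr1 : pruned (lb c) s1.
    move: hpt; rewrite /= (hP (lb c).-1); last by lia.
    case: (ltnP t r) => htr; first by rewrite hP; [left; exists t => //; lia|lia].
    have -> : t = r by lia.
    by right; rewrite PE.
  apply: (@wp_mono _ _ (scan gamma k N r L) _ _ _ (IH s1 cv1 rd1 hpw (tailv _ [::] f1 _))) => //.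
  move=> L' s2 [q1 q2 q3 q4 q5 q6 q7].
  have q2' : rmem s2 (Pstar, 0%N, r) <= rmem s (Pstar, 0%N, r) by rewrite -PE.
  split => //.
  - apply: scan_frame_trans f1 q1 => l; rewrite ?inE; first by move=> ->.
    by move=> ->; rewrite orbT.
  - case: q3 => [[-> ->]|[l hl q3]]; first by left; rewrite PE d1.2.
    by right; exists l => //=; rewrite inE hl orbT.
  - exact: subseq_trans q4 (subseq_cons _ _).
  - move=> l; rewrite inE => /orP[/eqP ->|]; last exact: q6.
    by right; apply: pruned_le pr1.
  - move=> l; rewrite inE => /orP[/eqP -> _|]; last exact: q7.
    by apply: pruned_le pr1.
have PvE : rmem s1 (Pstar, 0%N, (lb c).-1) = Pv (lb c).-1 by rewrite cv1 //; lia.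
have errE : err c' = E (lb c) r by case: hv' => _ _ ->; rewrite e1 e2.
apply: wp_read; apply: wp_op; apply: wp_op; apply: wp_read; apply: wp_leq.
rewrite e1 subn1; apply: wp_bind.
apply: (@wp_mono _ _ _ (fun _ s2 => [/\ scan_frame r [::] s1 s2,
    rmem s2 (Pstar, 0%N, r) <= rmem s1 (Pstar, 0%N, r),
    rmem s2 (Pstar, 0%N, r) <= value (lb c) &
    (rmem s2 (Pstar, 0%N, r) = rmem s1 (Pstar, 0%N, r) /\ nmem s2 r = nmem s1 r) \/
    (nmem s2 r = (lb c).-1 /\ rmem s2 (Pstar, 0%N, r) = value (lb c))])).
  rewrite /= PvE errE -/(value (lb c)).
  case: leP => hb; rewrite /wp /=; last first.
    by split => //; [exact: ltW|left].
  split.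
  - split => [a _ /negPf /= ->//|j /negPf /= ->//].
  - by rewrite eqxx.
  - by rewrite eqxx.
  - by right; rewrite !eqxx.
move=> _ s2 [w1 w2 w3 w4].
apply: wp_op; apply: wp_read; apply: wp_leq.
pose s3 := step (step (step s2)).
have f2 : scan_frame r [:: lb c] s s2 by apply: scan_frame_trans f1 w1.
have cv2 : covers s2.
  by move=> i hi; rewrite w1.1 ?cv1 // ?andbF // !xpair_eqE /=; lia.
have vc2 s' : scan_frame r (lbs L) s2 s' -> valid r c' s'.
  case: hv' => v1 v2 v3 v4 hf; split=> // hk i hi.
  rewrite hf.1 ?w1.1 //=; first exact: v4.
  by rewrite e1; apply/negP => /notin; rewrite ltnn.
have or2 : rmem s2 (Pstar, 0%N, r) <= rmem s (Pstar, 0%N, r) by rewrite -PE.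
have org2 : (rmem s2 (Pstar, 0%N, r) = rmem s (Pstar, 0%N, r) /\ nmem s2 r = nmem s r) \/
    (nmem s2 r = (lb c).-1 /\ rmem s2 (Pstar, 0%N, r) = value (lb c)).
  by case: w4 => [[-> ->]|]; [left; rewrite PE d1.2|right].
case: ifP => hcont; last first.
  move: hcont => /negbT; rewrite /= errE -ltNge => hcont.
  rewrite /wp /=; split.
  - apply: scan_frame_trans (f2 : scan_frame r [:: lb c] s s3) (_ : scan_frame r [::] s3 s3) => //.
    by move=> l /=; rewrite !inE => ->.
  - by [].
  - case: org2 => [|h]; first by left.
    by right; exists (lb c); rewrite //= mem_head.
  - by rewrite /= e1 eqxx subseq_refl.
  - split; first exact: (vc2 s3).
    by apply: (tailv _ [::]).
  - move=> l; rewrite inE => /orP[/eqP ->|hl]; left; first exact: w3.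
    have := notin _ hl; have := all_valid_lb hv hl => hl1 hl2.
    apply/ltW/(lt_le_trans hcont).
    (* An unvisited l is at most lb c - 1, so E l r can be split there to bound it below by the
       error of c. *)
    have lbE : (lb c).-1.+1 = lb c by lia.
    have hsp : E l (lb c).-1 + E (lb c) r <= E l r.
      by have := @itv_error_split l (lb c).-1 r; rewrite lbE; apply; lia.
    have e0 := itv_error_ge0 k bk f l ((lb c).-1.+1 - l).
    have p0 : 0 <= Pv l.-1 by apply: Pv0; lia.
    by rewrite /value; lra.
  - by move=> l /= ; rewrite e1 => -> .
apply: wp_bind.
have rd2 := scan_frame_ready f2 hrd.
apply: (@wp_mono _ _ (scan gamma k N r L) _ _ _ (IH s3 cv2 rd2 hpw (tailv s3 [::] f2 _))) => //.
move=> L' s4 [q1 q2 q3 q4 q5 q6 q7].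
apply: wp_ret; split => /=.
- apply: scan_frame_trans (f2 : scan_frame r [:: lb c] s s3) q1 => l; rewrite ?inE.
    by move=> ->.
  by move=> ->; rewrite orbT.
- exact: le_trans q2 or2.
- case: q3 => [[-> ->]|[l hl q3]]; last by right; exists l => //; rewrite inE hl orbT.
  case: org2 => [h|h]; first by left.
  by right; exists (lb c); rewrite ?mem_head.
- by rewrite e1 eqxx.
- by split => //; apply: vc2.
- move=> l; rewrite inE => /orP[/eqP ->|]; last exact: q6.
  by left; apply: le_trans w3.
- move=> l; rewrite e1 !inE negb_or => /orP[/eqP ->|hl /andP[_]]; last exact: q7.
  by rewrite eqxx.
Qed.

End Scan.
End Pruning.

(** * The dynamic program and the reconstruction *)

Section DynamicProgram.
Variables (R : realType) (k N : nat) (beta gamma : R) (f : nat -> R).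
Local Notation bk := (beta ^+ k).
Local Notation E l r := (itv_error k bk f l (r.+1 - l)).
Local Notation ready := (ready k N beta f).
Local Notation lbs L := [seq lb c | c <- L].

(** With the value 0 at index 0, the initialization of P*_r by E^{1:r} is the Bellman term of the
    left bound 1. *)
Definition optimal_value (s : state R) (r : nat) : R :=
  if r is 0 then 0 else rmem s (Pstar, 0%N, r) + gamma.

(* A pruned left bound l is dominated by t + 1. *)
Record dp_invariant (r : nat) (L : seq (candidate R)) (s : state R) : Prop := DPInvariant {
  dp_ready : ready s;
  dp_err1 : forall i, (0 < i <= N)%N -> rmem s (Err1, 0%N, i) = E 1%N i;
  dp_sorted : pairwise gtn (lbs L);
  dp_valid : all_valid k beta f r L s;
  dp_origin : forall i, (0 < i < r)%N -> (nmem s i < i)%N /\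
    optimal_value s i = optimal_value s (nmem s i) + E (nmem s i).+1 i + gamma;
  dp_le : forall l i, (0 < l <= i)%N -> (i < r)%N ->
    optimal_value s i <= optimal_value s l.-1 + E l i + gamma;
  dp_ge0 : forall i, (0 < i < r)%N -> 0 <= rmem s (Pstar, 0%N, i);
  dp_pruned : forall l, (1 < l <= r)%N -> l \notin lbs L ->
    exists2 t, (l <= t < r)%N &
      rmem s (Pstar, 0%N, t) <= rmem s (Pstar, 0%N, l.-1) + E l t }.

Lemma dp_invariant_step (r : nat) (L : seq (candidate R)) (s : state R) :
  (0 < k)%N -> 0 < gamma -> (1 < r <= N)%N -> dp_invariant r L s ->
  wp (let! e := read R (Err1, 0, r)%N in
      write (Pstar, 0, r)%N e;;
      writeN R r 0;;
      let! L' := scan gamma k N r L in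
      Ret (Candidate r.+1 r.+1 0 :: L')) (dp_invariant r.+1) s.
Proof.
move=> k_gt0 gamma_gt0 hr [h1 h2 h3 h4 h5 h6 h7 h8].
apply: wp_read; apply: wp_write; apply: wp_writeN.
pose s1 := step (storeN r 0 (step (store (Pstar, 0%N, r) (rmem s (Err1, 0%N, r)) (step s)))).
rewrite -[step (storeN _ _ _)]/s1.
pose Pv i := rmem s (Pstar, 0%N, i).
have d1 a : a != (Pstar, 0%N, r) -> rmem s1 a = rmem s a by move=> /negPf /= ->.
have n1 j : j != r -> nmem s1 j = nmem s j by move=> /negPf /= ->.
have p1 : rmem s1 (Pstar, 0%N, r) = E 1%N r by rewrite /= eqxx h2 //; lia.
have c1 : covers r Pv s1.
  by move=> i hi; rewrite d1 // !xpair_eqE /=; lia.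
have f1 : scan_frame r [::] s s1 by split=> [a _|j]; [exact: d1|exact: n1].
have rd1 : ready s1 := scan_frame_ready f1 h1.
have v1 : all_valid k beta f r L s1.
  by apply: (all_valid_frame (W := fun a => a == (Pstar, 0%N, r))) h4 => // a; exact: d1.
apply: wp_bind.
have hPv i : (0 < i < r)%N -> 0 <= Pv i by exact: h7.
have rN : (r <= N)%N by case/andP: hr.
apply: (wp_mono (wp_scan gamma rN hPv c1 rd1 h3 v1)) => L' s2 [q1 q2 q3 q4 q5 q6 q7].
apply: wp_ret.
have PE i : i != r -> rmem s2 (Pstar, 0%N, i) = Pv i.
  by move=> ir; rewrite q1.1 // ?d1 //; rewrite !xpair_eqE.
have nE i : i != r -> nmem s2 i = nmem s i by move=> ir; rewrite q1.2 // n1.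
have oE i : i != r -> optimal_value s2 i = optimal_value s i.
  by case: i => // i ir; rewrite /= PE.
have Lr l : l \in lbs L -> (1 < l <= r)%N by exact: all_valid_lb v1.
have L'r l : l \in lbs L' -> (1 < l <= r)%N by exact: all_valid_lb q5.
have orE : optimal_value s2 r = rmem s2 (Pstar, 0%N, r) + gamma.
  by case: (r) hr.
have obE l : (1 < l <= r)%N -> optimal_value s2 l.-1 = Pv l.-1 + gamma.
  by case: l => [|[|l]] // hl; rewrite /= PE //; lia.
have origin : (nmem s2 r < r)%N /\
    optimal_value s2 r = optimal_value s2 (nmem s2 r) + E (nmem s2 r).+1 r + gamma.
  case: q3 => [[e1 e2]|[l /Lr hl [e1 e2]]].
    by rewrite orE e1 e2 p1 /= eqxx /= add0r; split => //; lia.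
  rewrite orE e1 obE // e2 /value prednK; last by lia.
  by split; [lia|ring].
have prunedE l : pruned k beta f r Pv l s2 -> (1 < l <= r)%N ->
    exists2 t, (l <= t < r.+1)%N &
      rmem s2 (Pstar, 0%N, t) <= rmem s2 (Pstar, 0%N, l.-1) + E l t.
  move=> [[t ht hp]|hp] hl; last by exists r; [lia|]; rewrite (PE l.-1) //; lia.
  by exists t; [lia|]; rewrite !PE //; lia.
have le_r l : (1 < l <= r)%N -> optimal_value s2 r <= optimal_value s2 l.-1 + E l r + gamma.
  have [m] := ubnP (r - l); elim: m l => // m IH l hm hl.
  (* For t < r, the last intervals starting at l and at t + 1 cost one gamma each, so the terms in
     gamma cancel after superadditivity. For t = r a whole gamma is to spare. *)
  have dominated : (exists2 t, (l <= t < r.+1)%N &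
      rmem s2 (Pstar, 0%N, t) <= rmem s2 (Pstar, 0%N, l.-1) + E l t) ->
      optimal_value s2 r <= optimal_value s2 l.-1 + E l r + gamma.
    move=> [t ht hp]; rewrite obE // -PE; last by lia.
    case: (ltnP t r) => htr; last first.
      have rt : r = t by lia.
      by rewrite orE rt; move: hp gamma_gt0; lra.
    have ht1 : (1 < t.+1 <= r)%N by lia.
    have := IH _ _ ht1; rewrite obE //= -PE; last by lia.
    have hlt : (0 < l <= t)%N by lia.
    have := itv_error_split k beta f hlt htr.
    move=> hs hi; have := hi ltac:(lia); move: hp hs gamma_gt0; lra.
  case: (boolP (l \in lbs L)) => hL.
    case: (q6 l hL) => [hv|/prunedE]; last by move=> h; apply: dominated; apply: h.
    by rewrite orE obE //; move: hv; rewrite /value; lra.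
  apply: dominated; have [t ht hp] := h8 l hl hL.
  by exists t; [lia|rewrite !PE //; lia].
split.
- exact: scan_frame_ready q1 rd1.
- by move=> i hi; rewrite q1.1 // d1 // h2.
- rewrite /= (subseq_pairwise q4 h3) andbT; apply/allP => l /L'r /=; lia.
- split; last by apply: (all_valid_frame (W := xpred0)) q5.
  split=> //=; first by lia.
    by rewrite itv_error_small //; lia.
  by move=> hk; lia.
- move=> i hi; case: (eqVneq i r) => [->|ir]; first exact: origin.
  have [|e1 e2] := h5 i; first by lia.
  by rewrite nE // !oE //; lia.
(* The left bound 1 is never a candidate: its term is the initial value of P*_r, which the scan can
   only decrease. *)
- move=> l i hl hi; case: (eqVneq i r) => [ir|ir]; last first.
    by rewrite !oE ?h6 //; lia.
  rewrite ir in hl *; case: (eqVneq l 1%N) => [->|l1]; last by apply: le_r; lia.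
  by rewrite orE /= add0r lerD2r -p1.
- move=> i hi; case: (eqVneq i r) => [->|ir]; last by rewrite PE // hPv //; lia.
  case: q3 => [[-> _]|[l /Lr hl [_ ->]]]; first by rewrite p1 itv_error_ge0.
  rewrite /value !addr_ge0 ?itv_error_ge0 // ?hPv //; first by lia.
  exact: ltW.
- move=> l hl; rewrite /= inE negb_or => /andP[lr hL'].
  have hl' : (1 < l <= r)%N by lia.
  case: (boolP (l \in lbs L)) => hL; first by apply: prunedE => //; exact: q7.
  have [t ht hp] := h8 l hl' hL.
  by exists t; [lia|rewrite !PE //; lia].
Qed.

Lemma wp_dynamic_program (s : state R) :
  (0 < k)%N -> (0 < N)%N -> 0 < gamma -> ready s ->
  wp (dynamic_program gamma k N) (fun _ s' => ready s' /\
    (forall i, (0 < i <= N)%N -> (nmem s' i < i)%N /\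
      optimal_value s' i = optimal_value s' (nmem s' i) + E (nmem s' i).+1 i + gamma) /\
    (forall l i, (0 < l <= i)%N -> (i <= N)%N ->
      optimal_value s' i <= optimal_value s' l.-1 + E l i + gamma)) s.
Proof.
move=> k_gt0 N_gt0 gamma_gt0 hrd; rewrite /dynamic_program; apply: wp_bind.
apply: (wp_mono (wp_first_errors k_gt0 N_gt0 hrd)) => _ s1 [h1 h2 h3].
apply: wp_op; apply: wp_write; apply: wp_writeN; apply: wp_bind.
have E11 : E 1%N 1%N = 0 by rewrite itv_error_small.
have E22 : E 2%N 2%N = 0 by rewrite itv_error_small.
have := @wp_fold R _ (fun r L s' => dp_invariant r L s') 2 N.+1.
rewrite /from_to (maxn_idPr _) // => h; apply: (wp_mono (h _ _ _ _ _)) => {h}.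
- split=> //=.
  + by split => //; split => //= hk; lia.
  + move=> i hi; have -> : i = 1%N by lia.
    by rewrite eqxx /= E11 !addr0.
  + move=> l i hl hi; have -> : i = 1%N by lia.
    have -> : l = 1%N by lia.
    by rewrite /= E11 addr0.
  + move=> i hi; have -> : i = 1%N by lia.
    by rewrite eqxx.
  + by move=> l hl; rewrite inE; lia.
- move=> r L s2 hr hinv; rewrite addn1.
  apply: (@dp_invariant_step r L (step s2)) => //.
  case: hinv => *; split; try assumption.
  by apply: (all_valid_frame (W := xpred0)) (leqnn r) _ _ _; last eassumption.
- by move=> L s2 [g1 g2 g3 g4 g5 g6 g7 g8]; apply: wp_ret.
Qed.

Lemma wp_segments (n r : nat) (s : state R) :
  (forall i, (0 < i <= N)%N -> (nmem s i < i)%N) -> (r <= n)%N -> (r <= N)%N ->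
  wp (segments R n r) (fun L s' => [/\ chain r L,
    forall I, I \in L -> I.1 = (nmem s I.2).+1, rmem s' = rmem s & nmem s' = nmem s]) s.
Proof.
move=> hJ; elim: n r s hJ => [|n IH] r s hJ rn rN.
  by rewrite /wp /=; split => //; lia.
rewrite /segments -/segments; case: eqP => [->|/eqP r0]; first by [].
apply: wp_tick; apply: wp_readN; apply: wp_bind.
have hr : (nmem s r < r)%N by apply: hJ; lia.
apply: (@wp_mono _ _ (segments R n _) _ _ _ (IH _ (step (step s)) hJ _ _)); [rewrite /=; lia..|].
move=> L s' [h1 h2 h3 h4]; apply: wp_ret; split => //.
- by rewrite addn1 /= eqxx hr.
- by move=> I; rewrite inE => /orP[/eqP ->|/h2 //]; rewrite addn1.
Qed.

(** The second conjunct carries the induction: the remaining intervals lie to the left, so the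
    solution already written on l:r survives. *)
Lemma wp_solve_all (r : nat) (L : seq (nat * nat)) (s : state R) :
  ready s -> chain r L -> (r <= N)%N ->
  wp (for_each L (fun lr => solve k N bk lr.1 lr.2)) (fun _ s' =>
    (forall I, I \in L -> itv_cost k bk f I.1 (I.2.+1 - I.1) (sol s') = E I.1 I.2) /\
    forall i, (r < i)%N -> sol s' i = sol s i) s.
Proof.
elim: L r s => [|[l r'] L IH] r s hrd /=; first by split.
move=> /and3P[/eqP -> hl hL] hr.
change (wp (bind (solve k N bk l r)
  (fold L (fun (_ : unit) lr => solve k N bk lr.1 lr.2))) (fun _ s' =>
    (forall I, I \in (l, r) :: L -> itv_cost k bk f I.1 (I.2.+1 - I.1) (sol s') = E I.1 I.2) /\
    forall i, (r < i)%N -> sol s' i = sol s i) (step s)).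
apply: wp_bind; apply: (wp_mono (wp_solve (s := step s) hrd hl hr)) => -[] s1 [h1 h2].
have rd1 : ready s1.
  apply: ready_same_outside h2 hrd => -[[ar i] j] /=.
  by rewrite /in_solve /=; case: ar.
apply: (wp_mono (IH l.-1 s1 rd1 hL _)); first by lia.
move=> _ s2 [g1 g2]; split.
  move=> I; rewrite inE => /orP[/eqP ->|]; last exact: g1.
  rewrite /= -h1; apply: itv_cost_ext => i hi; apply: g2; lia.
move=> i hi; rewrite g2; last by lia.
by rewrite /sol h2.1 // /in_solve /=; lia.
Qed.

End DynamicProgram.

(** * Global minimality of the output *)

Section Correctness.
Variables (R : realType) (k N : nat) (beta gamma : R) (f : 'rV[R]_N).

Lemma initial_data (i : nat) : rmem (initial_state f) (Data, 0%N, i) = entry f i.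
Proof. by case: i. Qed.

Lemma mumford_shah_correct : (0 < k)%N -> (0 < N)%N -> 0 < gamma ->
  exists P : {set 'I_N * 'I_N},
    lists_partition (output_intervals k beta gamma f) P /\
    global_minimizer k beta gamma f (output_signal k beta gamma f) P.
Proof.
move=> k0 N0 g0.
pose bk := beta ^+ k.
suff : wp (mumford_shah beta gamma k N) (fun L s' =>
    [/\ chain N L,
      forall I, I \in L -> itv_cost k bk (entry f) I.1 (I.2.+1 - I.1) (sol s') =
        itv_error k bk (entry f) I.1 (I.2.+1 - I.1) &
      exists2 B : nat -> R, B 0%N = 0 /\ bellman_le k beta gamma f B &
        forall I, I \in L -> B I.2 = B I.1.-1 +
          itv_error k bk (entry f) I.1 (I.2.+1 - I.1) + gamma]) (initial_state f).
  case; rewrite -/(algorithm k beta gamma f) -/(output_intervals k beta gamma f).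
  move=> hL hcost [B [B0 hB] hBL].
  have [|P [h1 h2 h3]] := chain_functional (u := output_signal k beta gamma f) B0 hL hBL.
    (* The output signal agrees with [Sol] on 1:N only, and the cost of an interval sees nothing
       else. *)
    move=> [l r] IL; have := chain_mem hL IL; rewrite -hcost //= => hI.
    apply: itv_cost_ext => i hi.
    have hi' : (i.-1 < N)%N by lia.
    have iE : i = (Ordinal hi').+1 by rewrite /=; lia.
    by rewrite iE entryE mxE.
  exists P; split => //; split => // v Q hQ; rewrite h3.
  exact: bellman_le_functional.
rewrite /mumford_shah; apply: wp_bind.
apply: (wp_mono (wp_power beta k _)) => _ s1 [-> h1]; apply: wp_bind.
apply: (wp_mono (wp_precompute k N beta _)) => _ s2 [t2 h2]; apply: wp_bind.
have rd2 : ready k N beta (entry f) s2.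
  by split => // i; rewrite h2.1 // h1.1 // initial_data.
apply: (wp_mono (wp_dynamic_program k0 N0 g0 rd2)) => _ s3 [rd3 [o3 l3]]; apply: wp_bind.
have J3 i : (0 < i <= N)%N -> (nmem s3 i < i)%N by case/o3.
apply: (wp_mono (wp_segments J3 (leqnn N) (leqnn N))) => L s4 [c4 j4 m4 n4]; apply: wp_bind.
have rd4 : ready k N beta (entry f) s4 by case: rd3; split; rewrite /stores_theta ?m4.
apply: (wp_mono (wp_solve_all rd4 c4 (leqnn N))) => _ s5 [h5 _].
apply: wp_ret; split => //.
exists (optimal_value gamma s3); first by split => // l i hl hi; apply: l3.
move=> [l r] IL; have /= hI := chain_mem c4 IL.
have [|_ ->] := o3 r; first by lia.
by have /= -> := j4 _ IL.
Qed.

End Correctness.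

(** * Running time *)

Section Cost.
Variable V : Type.

(* [cost p Q]: whatever values the instructions return, p ends with a result a after t
   units of time such that Q a t. *)
Fixpoint cost (A : Type) (p : prog V A) (Q : A -> nat -> Prop) : Prop :=
  let Q' a t := Q a t.+1 in
  match p with
  | Ret a => Q a 0%N
  | Tick p' => cost p' Q'
  | Op _ h => forall x, cost (h x) Q'
  | Leq _ _ h => forall b, cost (h b) Q'
  | Read _ h => forall x, cost (h x) Q'
  | Write _ _ p' => cost p' Q'
  | ReadN _ h => forall n, cost (h n) Q'
  | WriteN _ _ p' => cost p' Q'
  end.

Lemma cost_mono (A : Type) (p : prog V A) (Q Q' : A -> nat -> Prop) :
  (forall a t, Q a t -> Q' a t) -> cost p Q -> cost p Q'.
Proof.
elim: p Q Q' => [a|p IH|o h IH|x y h IH|a h IH|a x p IH|i h IH|i n p IH] Q Q' QQ' /=.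
- exact: QQ'.
- by apply: IH => a t; apply: QQ'.
- by move=> H x; apply: IH (H x) => a t; apply: QQ'.
- by move=> H b; apply: IH (H b) => a t; apply: QQ'.
- by move=> H x; apply: IH (H x) => b t; apply: QQ'.
- by apply: IH => b t; apply: QQ'.
- by move=> H x; apply: IH (H x) => b t; apply: QQ'.
- by apply: IH => b t; apply: QQ'.
Qed.

Lemma cost_bind (A B : Type) (p : prog V A) (g : A -> prog V B) (Q : B -> nat -> Prop) :
  cost p (fun a t => cost (g a) (fun b t' => Q b (t + t')%N)) -> cost (bind p g) Q.
Proof.
elim: p Q => [a|p IH|o h IH|x y h IH|a h IH|a x p IH|i h IH|i n p IH] Q //=.
all: by [move=> H; apply: IH|move=> H ?; apply: IH].
Qed.

Definition bounded (A : Type) (p : prog V A) (n : nat) : Prop :=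
  cost p (fun _ t => (t <= n)%N).

Lemma bounded_le (A : Type) (p : prog V A) (m n : nat) :
  (m <= n)%N -> bounded p m -> bounded p n.
Proof. by move=> mn; apply: cost_mono => _ t /leq_trans; apply. Qed.

Lemma bounded_bind (A B : Type) (p : prog V A) (g : A -> prog V B) (m n : nat) :
  bounded p m -> (forall a, bounded (g a) n) -> bounded (bind p g) (m + n).
Proof.
move=> hp hg; apply: cost_bind; apply: cost_mono hp => a t tm.
by apply: cost_mono (hg a) => b t' tn; apply: leq_add.
Qed.

Lemma bounded_fold (T : eqType) (A : Type) (s : seq T) (body : A -> T -> prog V A)
    (acc : A) (n : nat) :
  (forall a x, x \in s -> bounded (body a x) n) -> bounded (fold s body acc) (size s * n.+1).
Proof.
elim: s acc => //= x s IH acc h; rewrite mulSn.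
rewrite -[bounded _ _]/(bounded (bind (tick V) (fun _ => bind (body acc x) (fold s body))) _).
rewrite -add1n -addnA; apply: bounded_bind => // _; apply: bounded_bind => [|a].
  by apply: h; apply: mem_head.
by apply: IH => a' y ys; apply: h; rewrite inE ys orbT.
Qed.

Lemma bounded_for_each (T : eqType) (s : seq T) (body : T -> prog V unit) (m n : nat) :
  (size s <= m)%N -> (forall x, x \in s -> bounded (body x) n) ->
  bounded (for_each s body) (m * n.+1).
Proof.
move=> sm h; apply: (@bounded_le _ _ (size s * n.+1)); first by rewrite leq_mul2r sm orbT.
by apply: bounded_fold => _ x; apply: h.
Qed.

Lemma size_from_to (a b : nat) : size (from_to a b) = (b.+1 - a)%N.
Proof. by rewrite size_iota. Qed.

Lemma mem_from_to (a b i : nat) : (i \in from_to a b) = (a <= i <= b)%N.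
Proof. by rewrite mem_index_iota. Qed.

Variable k : nat.

Lemma bounded_power (x : V) : bounded (power x k) (1 + k * 2).
Proof.
apply: (bounded_bind (m := 1)) => // one.
apply: (@bounded_le _ _ (size (from_to 1 k) * 2)); first by rewrite size_from_to subn1.
exact: bounded_fold.
Qed.

Lemma bounded_init_R : bounded (init_R V k) (k * (k * 3).+1).
Proof.
apply: bounded_for_each => [|i _]; first by rewrite size_from_to subn1.
by apply: bounded_for_each => [|j _ x]; first by rewrite size_from_to subn1.
Qed.

Lemma bounded_rotate (t : V) (x y : addr) : bounded (rotate t x y) 12.
Proof. by []. Qed.

Lemma bounded_eliminate (t : V) (r j : nat) : (0 < j)%N ->
  bounded (eliminate t r (r - k + j)) (k.+1 * 13).
Proof.
move=> j0; apply: bounded_for_each => [|c _]; last exact: bounded_rotate.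
by rewrite size_from_to; lia.
Qed.

Lemma bounded_extend_R (bk : V) (r : nat) :
  bounded (extend_R k bk r) (2 + (k * 2 + (1 + k.+1 * 4))).
Proof.
apply: (bounded_bind (m := 1)) => // zero; apply: (bounded_bind (m := 1)) => // one.
apply: bounded_bind => [|_].
  by apply: bounded_for_each => // ; rewrite size_from_to; lia.
apply: bounded_bind => // _; apply: bounded_for_each => [|j _ x y].
  by rewrite size_from_to.
by [].
Qed.

Lemma bounded_precompute :
  exists c, forall (N : nat) (bk : V), bounded (precompute k N bk) (c * N.+1).
Proof.
pose e := (2 + (k * 2 + (1 + k.+1 * 4)))%N.
(* Two reads, eight instructions for the angle and one write, then the elimination of k + 1
   columns. *)
pose b := (11 + k.+1 * 13)%N.
pose d := (e + k.+1 * b.+1)%N.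
exists (k * (k * 3).+1 + d.+1)%N => N bk.
apply: (@bounded_le _ _ (k * (k * 3).+1 + N * d.+1)); first by nia.
apply: bounded_bind => [|_]; first exact: bounded_init_R.
apply: bounded_for_each => [|r _]; first by rewrite size_iota leq_subr.
apply: bounded_bind => [|_]; first exact: bounded_extend_R.
apply: bounded_for_each => [|j]; first by rewrite size_from_to; lia.
rewrite mem_from_to => hj.
rewrite /b -[11%N]/(1 + (1 + (8 + 1)))%N -!addnA.
apply: bounded_bind => // a; apply: bounded_bind => // a'.
apply: bounded_bind => [|t]; first by [].
by apply: bounded_bind => // _; apply: bounded_eliminate; lia.
Qed.

Lemma bounded_init_q (l : nat) : bounded (init_q V k l) (k * 3).
Proof.
by apply: bounded_for_each => [|i _ x]; first by rewrite size_from_to subn1.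
Qed.

Lemma bounded_update_q (N l r : nat) : bounded (update_q V k N l r) (4 + k.+1 * 14).
Proof.
rewrite -[4%N]/(1 + (1 + (1 + 1)))%N -!addnA.
apply: bounded_bind => // x; apply: bounded_bind => // _.
apply: bounded_bind => // zero; apply: bounded_bind => // _.
apply: bounded_for_each => [|j _]; first by rewrite size_from_to; lia.
by rewrite -[13%N]/(1 + 12)%N; apply: bounded_bind => // t.
Qed.

Lemma bounded_update_error : exists c, forall (N l t : nat) (e : V),
  bounded (update_error k N l t e) c.
Proof.
exists (k * 3 + ((4 + k.+1 * 14) + 3))%N => N l t e; rewrite /update_error.
case: ifP => _; first by move=> x /=; lia.
apply: bounded_bind => [|_].
  by case: ifP => _; [exact: bounded_init_q|].
by apply: bounded_bind => [|_]; first exact: bounded_update_q.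
Qed.

Lemma bounded_first_errors : exists c, forall N, bounded (first_errors V k N) (c * N.+1).
Proof.
have [c hc] := bounded_update_error.
exists (c + 4)%N => N; apply: (@bounded_le _ _ (2 + N * (1 + (c + 1)).+1)); first by nia.
rewrite -[2%N]/(1 + 1)%N -addnA.
apply: bounded_bind => // zero; apply: bounded_bind => // _.
apply: bounded_for_each => [|r _]; first by rewrite size_from_to; lia.
by apply: bounded_bind => // x; apply: bounded_bind => // _.
Qed.

Lemma cost_advance : exists c, forall (N n : nat) (x : candidate V),
  cost (advance k N n x) (fun oc t => (t <= c * n)%N /\
    (if oc is Some y then rb y = (rb x + n)%N else True)).
Proof.
have [c hc] := bounded_update_error.
exists (c + 5)%N => N; elim=> [|n IH] x; first by rewrite /= muln0 addn0.
rewrite /advance -/advance; apply: cost_bind; rewrite /=; apply: cost_bind.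
apply: cost_mono (hc N (lb x) (rb x) (err x)) => e t tc /= p y q b.
case: b => /=; first by split => //; lia.
apply: cost_mono (IH (Candidate (lb x) (rb x + 1) e)) => oc t' /= [h1 h2]; split.
  by lia.
by case: oc h2 => // z ->; lia.
Qed.

(** The potential of the amortized analysis: the error updates still owed to reach right bound r. A
    new round adds at most one per candidate. *)
Definition lag (r : nat) (L : seq (candidate V)) : nat := sumn [seq (r - rb x)%N | x <- L].

Lemma lagS (r : nat) (L : seq (candidate V)) : (lag r.+1 L <= lag r L + size L)%N.
Proof. by rewrite /lag; elim: L => //= x L IH; lia. Qed.

(* Each error update decreases the lag by one, which pays for it. *)
Lemma cost_scan : exists c d, forall (gamma : V) (N r : nat) (L : seq (candidate V)),
  cost (scan gamma k N r L) (fun L' t =>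
    (size L' <= size L)%N /\ (t + c * lag r L' <= d * (size L).+1 + c * lag r L)%N).
Proof.
have [c hc] := cost_advance.
(* Per visited candidate: one tick, five instructions up to the comparison with P*_r, two writes,
   three for the stopping test. *)
exists c, 11 => gamma N r; elim=> [|x L IH]; first by rewrite /=; split => //; lia.
rewrite /scan -/scan; apply: cost_bind; rewrite /=; apply: cost_bind.
apply: cost_mono (hc N (r - rb x)%N x) => oc t [h1 h2].
case: oc h2 => [y hy|_]; last first.
  apply: cost_mono (IH) => L' t' [g1 g2]; split; first exact: leqW.
  by move: g2; rewrite /lag /=; nia.
have ry : (r - rb y = 0)%N by lia.
have tail b' : cost (if b' then let! L'' := scan gamma k N r L in Ret (y :: L'') else Ret (y :: L))
    (fun L' t' => (size L' <= (size L).+1)%N /\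
       (t' + c * lag r L' <= 11 * (size L).+1 + c * lag r L)%N).
  case: b' => /=; last by split => //; rewrite /lag /= ry; lia.
  apply: cost_bind; apply: cost_mono (IH) => L'' t'' [g1 g2] /=; split => //.
  by move: g2; rewrite /lag /= ry; lia.
by move=> /= p q b pr; case=> /= u v b'; apply: cost_mono (tail b') => L' t' [g1 g2];
  split => //; move: g2; rewrite /lag /=; nia.
Qed.

Lemma bounded_dynamic_program : exists c, forall (gamma : V) (N : nat),
  bounded (dynamic_program gamma k N) (c * N.+1 ^ 2).
Proof.
have [e he] := bounded_first_errors.
have [c [d hcd]] := cost_scan.
exists (e + 3 + (4 + d + c))%N => gamma N.
(* One round: a tick, a read and two writes; then [d] per candidate for the scan and [c] per
   candidate for the lag added by the round. *)
pose D := (4 + (d + c) * N.+1)%N.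
apply: (@bounded_le _ _ (e * N.+1 + (3 + N * D))); first by rewrite /D; nia.
apply: bounded_bind => // _; rewrite -[3%N]/(1 + (1 + 1))%N -!addnA.
apply: bounded_bind => // zero; apply: bounded_bind => // _; apply: bounded_bind => // _.
apply: cost_bind => /=.
(* Here n rounds remain, starting with round i. The initial lag pays for updates postponed by
   earlier rounds. *)
suff H n i L : (n + i = N.+1)%N -> (0 < i)%N -> (size L < i)%N ->
    cost (fold (iota i n) (fun L r =>
      let! e := read V (Err1, 0, r)%N in
      write (Pstar, 0, r)%N e;;
      writeN V r 0;;
      let! L' := scan gamma k N r L in
      Ret (Candidate (r + 1) (r + 1) zero :: L')) L)
    (fun _ t => t <= n * D + c * lag i.-1 L)%N.
  case: (posnP N) => [N0|N0].
    by rewrite N0.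
  apply: cost_mono (H (N.+1 - 2)%N 2 [:: Candidate 2 2 zero] _ _ _) => //=; last by lia.
  by move=> _ t ht; move: ht; rewrite /lag /= muln0 !addn0 subn2 /=; nia.
elim: n i L => [|n IH] i L hn hi hL; first by [].
rewrite /= => x; apply: cost_bind; apply: cost_bind.
apply: cost_mono (hcd gamma N i L) => L' t [h1 h2] /=.
have hs : (size (Candidate (i + 1) (i + 1) zero :: L') < i.+1)%N by rewrite /=; lia.
have hn' : (n + i.+1 = N.+1)%N by lia.
apply: cost_mono (IH i.+1 _ hn' (ltn0Sn _) hs) => _ t' ht'.
have := lagS i.-1 L; rewrite prednK // => hlag.
have e0 : lag i (Candidate (i + 1) (i + 1) zero :: L') = lag i L'.
  by rewrite /lag /=; lia.
move: ht'; rewrite /= e0 /D mulSn => ht'.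
by nia.
Qed.

Lemma cost_segments (n r : nat) :
  cost (segments V n r) (fun L t => (size L <= n)%N /\ (t <= 2 * n)%N).
Proof.
elim: n r => [|n IH] r; first by [].
rewrite /segments -/segments; case: eqP => _ //= j; apply: cost_bind.
by apply: cost_mono (IH j) => L t [h1 h2] /=; split; lia.
Qed.

(** A bound by N instead of the interval length is crude, but suffices since there are at most N
    intervals. *)
Lemma bounded_solve : exists c, forall (N : nat) (bk : V) (l r : nat), (r <= N)%N ->
  bounded (solve k N bk l r) (c * N.+1).
Proof.
pose u := (4 + k.+1 * 14)%N.
pose e := (2 + (k * 2 + (1 + k.+1 * 4)))%N.
pose d := (u + (e + k.+1 * (1 + k.+1 * 13).+1))%N.
pose b := (1 + (k * 5 + 3))%N.
exists (3 + k * (k * 3).+1 + k * 3 + d.+1 + b.+1)%N => N bk l r rN.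
rewrite /solve; case: leqP => hn.
  apply: (@bounded_le _ _ (N.+1 * 3)); first by nia.
  apply: bounded_for_each => [|i _ x]; last by [].
  by rewrite size_from_to; lia.
apply: (@bounded_le _ _ (k * (k * 3).+1 + (k * 3 + (N.+1 * d.+1 + N.+1 * b.+1)))); first by nia.
apply: bounded_bind => [|_]; first exact: bounded_init_R.
apply: bounded_bind => [|_]; first exact: bounded_init_q.
apply: bounded_bind => [|_].
  apply: bounded_for_each => [|m _]; first by rewrite size_iota; lia.
  apply: bounded_bind => [|_]; first exact: bounded_update_q.
  apply: bounded_bind => [|_]; first exact: bounded_extend_R.
  apply: bounded_for_each => [|j]; first by rewrite size_from_to; lia.
  rewrite mem_from_to => hj; apply: bounded_bind => // t.
  by apply: bounded_eliminate; lia.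
apply: bounded_for_each => [|i _]; first by rewrite size_rev size_from_to; lia.
apply: bounded_bind => // y; apply: bounded_bind => [|z]; last by [].
set s := from_to _ _.
apply: (@bounded_le _ _ (size s * 5)); first by rewrite leq_mul2r size_from_to orbC; lia.
by apply: bounded_fold.
Qed.

Lemma cost_true (A : Type) (p : prog V A) (Q : A -> nat -> Prop) :
  (forall a t, Q a t) -> cost p Q.
Proof.
elim: p Q => [a|p IH|o h IH|x y h IH|a h IH|a x p IH|i h IH|i n p IH] Q HQ //=.
all: by [apply: IH => ? ?; apply: HQ|move=> ?; apply: IH => ? ?; apply: HQ].
Qed.

(** Under [cost] a read from J may return any number, so the intervals could be arbitrarily long.
    The bound is thus conditional on the returned list. *)
Lemma cost_mumford_shah : exists c, forall (beta gamma : V) (N : nat),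
  cost (mumford_shah beta gamma k N) (fun L t =>
    all (fun I => I.2 <= N)%N L -> (t <= c * N.+1 ^ 2)%N).
Proof.
have [cp hp] := bounded_precompute.
have [cd hd] := bounded_dynamic_program.
have [cs hs] := bounded_solve.
exists (1 + k * 2 + cp + cd + 2 + cs.+1)%N => beta gamma N.
apply: cost_bind; apply: cost_mono (bounded_power beta) => bk t1 ht1.
apply: cost_bind; apply: cost_mono (hp N bk) => _ t2 ht2.
apply: cost_bind; apply: cost_mono (hd gamma N) => _ t3 ht3.
apply: cost_bind; apply: cost_mono (cost_segments N N) => L t4 [hL ht4].
apply: cost_bind; case: (boolP (all (fun I => I.2 <= N)%N L)) => hN; last first.
  (* The list is returned unchanged, so here the condition on the result fails and no bound is
     due. *)
  by apply: cost_true => _ t /= h; rewrite h in hN.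
apply: cost_mono (_ : bounded _ (N * (cs * N.+1).+1)) => [_ t5 ht5 _ /=|].
  by rewrite addn0; nia.
by apply: bounded_for_each => // I IL; apply: hs; apply: (allP hN).
Qed.

End Cost.

Lemma cost_run (R : realType) (A : Type) (p : prog R A) (Q : A -> nat -> Prop) (s : state R) :
  cost p Q -> exists2 t, Q (run p s).1 t & clock (run p s).2 = (clock s + t)%N.
Proof.
have aux (s1 s2 s3 : state R) (P : nat -> Prop) : clock s2 = (clock s1).+1 ->
    (exists2 t, P t.+1 & clock s3 = (clock s2 + t)%N) ->
    exists2 t, P t & clock s3 = (clock s1 + t)%N.
  by move=> -> [t ht ->]; exists t.+1 => //; rewrite addSnnS.
elim: p Q s => [a|p IH|o h IH|x y h IH|a h IH|a x p IH|i h IH|i n p IH] Q s /= H.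
  by exists 0%N => //; rewrite addn0.
- exact: aux (IH _ (step s) H).
- exact: aux (IH _ _ (step s) (H _)).
- exact: aux (IH _ _ (step s) (H _)).
- exact: aux (IH _ _ (step s) (H _)).
- exact: aux (IH _ (step (store a x s)) H).
- exact: aux (IH _ _ (step s) (H _)).
- exact: aux (IH _ (step (storeN i n s)) H).
Qed.

Theorem theorem6 (R : realType) (k : nat) (hk : (0 < k)%N) :
  (forall (N : nat) (f : 'rV[R]_N) (beta gamma : R),
     (0 < N)%N -> 0 < beta -> 0 < gamma ->
     exists P : {set 'I_N * 'I_N},
       lists_partition (output_intervals k beta gamma f) P /\
       global_minimizer k beta gamma f (output_signal k beta gamma f) P)
  /\
  (exists C : nat, forall (N : nat) (f : 'rV[R]_N) (beta gamma : R),
     (0 < N)%N -> 0 < beta -> 0 < gamma ->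
     (running_time k beta gamma f <= C * N ^ 2)%N).
Proof.
split=> [N f beta gamma N0 _ g0|]; first exact: mumford_shah_correct.
have [c hc] := cost_mumford_shah R k.
(* The factor 4 comes from (N + 1)^2 <= 4 N^2 for N >= 1. *)
exists (4 * c)%N => N f beta gamma N0 _ g0.
have [t ht] := cost_run (initial_state f) (hc beta gamma N).
rewrite /running_time /algorithm => ->; rewrite add0n.
(* Correctness enters the time bound here: the listed intervals are those of a partition of 1:N. *)
have bounded_N : all (fun I => I.2 <= N)%N (output_intervals k beta gamma f).
  have [P [/perm_mem eqP _]] := mumford_shah_correct beta f hk N0 g0.
  by apply/allP => I; rewrite eqP => /mapP[J _ ->]; apply: ltn_ord.
by apply: leq_trans (ht bounded_N) _; nia.
Qed.
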